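(* Given a survey dataset $D=\{(q^i,B^i)\}_{i\in[n]}$ with $m$ survey questions and $n$ rounds, the algorithm $\mathcal{A}$ described in the context (enumeration of orientation patterns via a prefix tree, with GARP tests, followed by a loop over the observed answers) determines whether $D$ is peak-oriented rationalizable in time polynomial in $m$ and $n$.
   Context: Notation: $[n]=\{1,\dots,n\}$; $\langle\cdot,\cdot\rangle$ is the standard inner product; $\operatorname{sign}(x)$ is $+1$, $0$, $-1$ for $x>0$, $x=0$, $x<0$; the signs $+,-$ are identified with $+1,-1$. For a concave function $u$, $\partial u(q)$ is its superdifferential at $q$. Survey dataset: $M_1,\dots,M_m>0$ and $X=\prod_{j=1}^m[0,M_j]$. For each round $i\in[n]$ there are $a^i\in\mathbb{R}^m$ and $\mu^i\in\mathbb{R}$ defining the budget $B^i=\{x\in X:\langle a^i,x\rangle=\mu^i\}$, and an observed answer $q^i$. Standing assumptions: all coordinates of each $a^i$ are nonzero, $B^i$ intersects the interior of $X$, and $q^i\in B^i$. Peak-oriented rationalizability: $D$ is peak-oriented rationalizable if there exist a peak $y^*\in X$, a continuous concave function $u:X\to\mathbb{R}$, and scalars $\lambda^i\in\mathbb{R}$ such that (i) $y^*\in\arg\max_{x\in X}u(x)$; (ii) $q^i\in\arg\max_{x\in B^i}u(x)$ for $i\in[n]$; (iii) $\lambda^i a^i\in\partial u(q^i)$ for $i\in[n]$; (iv) $\lambda^i a^i_j(y^*_j-q^i_j)\ge 0$ for $i\in[n]$, $j\in[m]$; (v) $\langle\lambda^i a^i,y^*-q^i\rangle>0$ for $i\in[n]$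 with $q^i\ne y^*$. Orthants and cones: $O^i_+=\{x\in X: a^i_j(x_j-q^i_j)\ge 0\ \text{for } j\in[m]\}$, $O^i_-=\{x\in X: a^i_j(x_j-q^i_j)\le 0\ \text{for } j\in[m]\}$, $C^i=O^i_+\cup O^i_-$. For $y\in C^i$ with $y\ne q^i$, $\sigma^i(y)$ is $+$ if $y\in O^i_+$ and $-$ if $y\in O^i_-$ (this is unique because $O^i_+\cap O^i_-=\{q^i\}$). Let $Q=\{q^1,\dots,q^n\}$. For $\sigma\in\{-,+\}^n$ let $R_\sigma=\bigcap_{i\in[n]}O^i_{\sigma^i}$, which is an axis-aligned box (possibly empty). Let $\Omega$ be the set of sign vectors $(\sigma^i(y))_{i\in[n]}$ with $y\in X\setminus Q$ and $y\in\bigcap_{i\in[n]}C^i$; equivalently $\sigma\in\Omega$ iff $R_\sigma\setminus Q\ne\varnothing$. GARP: a dataset $\{(x^t,p^t)\}_{t\in S}$ satisfies GARP if there is no sequence of indices $t_1,\dots,t_K\in S$ with $\langle p^{t_k},x^{t_k}-x^{t_{k+1}}\rangle\ge 0$ for $k\in[K-1]$ and $\langle p^{t_K},x^{t_K}-x^{t_1}\rangle>0$. For a dataset $\{(q^i,\sigma^i a^i)\}$, the $q^i$ play the role of the $x^t$ and the vectors $\sigma^i a^i$ that of the $p^t$. Enumeration procedure (computes $\Omega$): (1) Construct by trie insertion the prefix tree of $Q$: the nodes at depth $k\in\{0,\dots,m\}$ are the distinct prefixes $(q^i_1,\dots,q^i_k)$, each storing the observations having that prefix; the root is the empty prefix;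 the children of a node at depth $k<m$ correspond to the distinct values of the $(k+1)$-th coordinate among the observations it stores. (2) For a non-leaf node $u$ at depth $k$ with prefix $\pi(u)$ and child coordinate values $v_1<\dots<v_d$, the set $[0,M_{k+1}]\setminus\{v_1,\dots,v_d\}$ is partitioned into at most $d+1$ intervals. For each pair $(u,I)$ with $I$ one of these intervals, pick an arbitrary point $y\in X(u,I)=\{y\in X:(y_1,\dots,y_k)=\pi(u),\ y_{k+1}\in I\}$ and compute the pattern $\sigma=\tau(y)=(\tau^i(y))_{i\in[n]}$, where $\tau^i(y)=\operatorname{sign}\bigl(a^i_{d(i,y)}(y_{d(i,y)}-q^i_{d(i,y)})\bigr)$ and $d(i,y)=\min\{j\in[m]:y_j\ne q^i_j\}$. (3) Compute the box $R_\sigma$ coordinatewise and retain $\sigma$ in $\Omega$ if and only if $R_\sigma\setminus Q\ne\varnothing$. Algorithm $\mathcal{A}$, on input $D$: 1. Compute $\Omega$ by the enumeration procedure. 2. For each $\sigma\in\Omega$: if $\{(q^i,\sigma^i a^i)\}_{i\in[n]}$ satisfies GARP, choose $y^*\in R_\sigma\setminus Q$ and return ''$D$ is peak-oriented rationalizable with peak $y^*$''. 3. For each $y\in Q$: let $I=\{i\in[n]:q^i\ne y\}$; if $y\in C^i$ for every $i\in I$ and $\{(q^i,\sigma^i(y)a^i)\}_{i\in I}$ satisfies GARP, return ''$D$ is peak-oriented rationalizable with peak $y$''. 4. Return ''$D$ is not peak-oriented rationalizable''. *)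

(* Defs.v *)
From HB Require Import structures.
From mathcomp Require Import all_boot all_order all_algebra.
From mathcomp Require Import all_classical all_reals all_analysis.
Import numFieldNormedType.Exports.
Import Order.TTheory GRing.Theory Num.Theory.

Set Implicit Arguments.
Unset Strict Implicit.
Unset Printing Implicit Defensive.

Local Open Scope classical_set_scope.
Local Open Scope ring_scope.

Record survey (R : realType) (m n : nat) := Survey {
  cap : 'rV[R]_m;           (* M_1, ..., M_m *)
  a   : 'I_n -> 'rV[R]_m;
  mu  : 'I_n -> R;
  q   : 'I_n -> 'rV[R]_m
}.

Definition dot (R : realType) (m : nat) (x y : 'rV[R]_m) : R :=
  \sum_(j < m) x 0 j * y 0 j.

Definition argmax (R : realType) (T : Type) (A : set T) (u : T -> R) : set T :=
  [set y | A y /\ forall x, A x -> u x <= u y].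

Section Survey.
Context (R : realType) (m n : nat) (D : survey R m n).
Implicit Types (x y : 'rV[R]_m) (i : 'I_n) (j : 'I_m).

Definition X : set 'rV[R]_m := [set x | forall j, 0 <= x 0 j <= cap D 0 j].

Definition budget i : set 'rV[R]_m := [set x | X x /\ dot (a D i) x = mu D i].

Definition is_survey : Prop :=
  [/\ forall j, 0 < cap D 0 j,
      forall i j, a D i 0 j != 0,
      forall i, (budget i `&` X°) !=set0 &
      forall i, budget i (q D i)].

Definition concave (u : 'rV[R]_m -> R) : Prop :=
  convex_function (E := 'rV[R]_m) X (fun x => - u x).

(* [u] is a total function, but only its values on [X] matter. *)
Definition superdiff (u : 'rV[R]_m -> R) (z : 'rV[R]_m) : set 'rV[R]_m :=
  [set g | forall x, X x -> u x <= u z + dot g (x - z)].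

Definition rationalizable_with_peak (ystar : 'rV[R]_m) : Prop :=
  exists (u : 'rV[R]_m -> R) (lambda : 'I_n -> R),
    [/\ X ystar, {within X, continuous u} & concave u] /\
    [/\ argmax X u ystar,
        forall i, argmax (budget i) u (q D i),
        forall i, superdiff u (q D i) (lambda i *: a D i),
        forall i j, 0 <= lambda i * a D i 0 j * (ystar 0 j - q D i 0 j) &
        forall i, q D i <> ystar ->
          0 < dot (lambda i *: a D i) (ystar - q D i)].

Definition rationalizable : Prop :=
  exists ystar, rationalizable_with_peak ystar.

Definition orthant_pos i : set 'rV[R]_m :=
  [set x | X x /\ forall j, 0 <= a D i 0 j * (x 0 j - q D i 0 j)].

Definition orthant_neg i : set 'rV[R]_m :=
  [set x | X x /\ forall j, a D i 0 j * (x 0 j - q D i 0 j) <= 0].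

Definition answers : set 'rV[R]_m := range (q D).

(* The intersection is taken inside [X], so that it is [X] when [n = 0]. *)
Definition orthant_box (sigma : 'rV[R]_n) : set 'rV[R]_m :=
  [set x | X x /\ forall i,
     (if 0 < sigma 0 i then orthant_pos i else orthant_neg i) x].

End Survey.

Definition GARP (R : realType) (m : nat) (S : finType)
    (x p : S -> 'rV[R]_m) : Prop :=
  ~ exists (t1 : S) (ts : seq S),
      path (fun s t => 0 <= dot (p s) (x s - x t)) t1 ts /\
      0 < dot (p (last t1 ts)) (x (last t1 ts) - x t1).

(* A unit-cost real random-access machine.  A computation returns its value
  together with its running time.  Every arithmetic operation, comparison or
  sign test on reals costs 1, and so does every step of a list traversal
  (including appending lists and indexing into them).  What remains uncharged
  is the bounded work between two charges: building and destructuring data,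
  Boolean connectives and incrementing a counter. *)

Definition timed (A : Type) : Type := (A * nat)%type.

Definition ret A (x : A) : timed A := (x, 0%N).
Definition bind A B (c : timed A) (f : A -> timed B) : timed B :=
  let d := f c.1 in (d.1, (c.2 + d.2)%N).
Definition tick A (c : timed A) : timed A := (c.1, c.2.+1).
Definition op A (x : A) : timed A := tick (ret x).

Notation "'let*' x ':=' c 'in' f" := (bind c (fun x => f))
  (at level 200, x name, c at level 200, f at level 200,
   format "'[v' 'let*'  x  ':='  c  'in' '/' f ']'").

Section Lists.
Context {A B C : Type}.

Fixpoint foldT (f : A -> B -> timed B) (b : B) (s : seq A) : timed B :=
  tick (if s is x :: s' then let* r := foldT f b s' in f x r else ret b).

Fixpoint map2T (f : A -> B -> timed C) (s : seq A) (t : seq B) : timed (seq C) :=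
  tick (match s, t with
        | x :: s', y :: t' =>
            let* z := f x y in
            let* r := map2T f s' t' in
            ret (z :: r)
        | _, _ => ret [::]
        end).

Fixpoint nthT (x0 : A) (s : seq A) (k : nat) : timed A :=
  tick (match s, k with
        | [::], _ => ret x0
        | x :: _, 0%N => ret x
        | _ :: s', k'.+1 => nthT x0 s' k'
        end).

Fixpoint find_someT (f : A -> timed (option B)) (s : seq A) : timed (option B) :=
  tick (if s is x :: s' then
          let* r := f x in
          if r is Some y then ret (Some y) else find_someT f s'
        else ret None).

End Lists.

Definition catT A (s t : seq A) : timed (seq A) :=
  foldT (fun x r => ret (x :: r)) t s.
Definition rconsT A (s : seq A) (x : A) : timed (seq A) := catT s [:: x].
Definition mapT A B (f : A -> timed B) (s : seq A) : timed (seq B) :=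
  foldT (fun x r => let* y := f x in ret (y :: r)) [::] s.
Definition flatmapT A B (f : A -> timed (seq B)) (s : seq A) : timed (seq B) :=
  foldT (fun x r => let* ys := f x in catT ys r) [::] s.
Definition filterT A (p : A -> timed bool) (s : seq A) : timed (seq A) :=
  foldT (fun x r => let* b := p x in ret (if b then x :: r else r)) [::] s.
Definition allT A (p : A -> timed bool) (s : seq A) : timed bool :=
  foldT (fun x r => let* b := p x in ret (b && r)) true s.
Definition hasT A (p : A -> timed bool) (s : seq A) : timed bool :=
  foldT (fun x r => let* b := p x in ret (b || r)) false s.
Definition zipT A B (s : seq A) (t : seq B) : timed (seq (A * B)) :=
  map2T (fun x y => ret (x, y)) s t.

(* Vectors are lists of coordinates.  A sign is one of the reals 1, 0, -1. *)

Section Algorithm.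
Context {R : realFieldType}.
Implicit Types (x y z : R) (vec pi caps sigma : seq R) (I : interval R).

Definition addT x y : timed R := op (x + y).
Definition subT x y : timed R := op (x - y).
Definition mulT x y : timed R := op (x * y).
Definition divT x y : timed R := op (x / y).
Definition maxT x y : timed R := op (Num.max x y).
Definition minT x y : timed R := op (Num.min x y).
Definition sgT x : timed R := op (Num.sg x).
Definition eqT x y : timed bool := op (x == y).
Definition leT x y : timed bool := op (x <= y).
Definition ltT x y : timed bool := op (x < y).

Definition dotT (v w : seq R) : timed R :=
  let* p := map2T mulT v w in foldT addT 0 p.
Definition eqvT (v w : seq R) : timed bool :=
  let* e := map2T eqT v w in allT (fun b => ret b) e.

Record round := Round { coef : seq R; answer : seq R }.
Record instance := Instance { caps_of : seq R; rounds : seq round }.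
Implicit Types (r : round) (inp : instance).

Definition is_answerT (v : seq R) (rs : seq round) : timed bool :=
  hasT (fun r => eqvT v (answer r)) rs.

(* A node stores the rounds whose answer has the given prefix, and its children
   sorted by increasing coordinate value. *)
Inductive trie := Node of seq round & seq (R * trie).

Definition empty_trie : trie := Node [::] [::].

(* [key] is the part of [answer r] that remains to be read. *)
Fixpoint insertT r (key : seq R) (u : trie) : timed trie :=
  let: Node stored ch := u in
  tick (if key is v :: key' then
    let* ch' :=
      (fix insert_childT (ch : seq (R * trie)) : timed (seq (R * trie)) :=
         tick (match ch with
           | [::] =>
               let* w := insertT r key' empty_trie in
               ret [:: (v, w)]
           | c :: cs =>
               let* same := eqT v c.1 in
               if same then
                 let* w := insertT r key' c.2 in
                 ret ((v, w) :: cs)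
               else
                 let* before := ltT v c.1 in
                 if before then
                   let* w := insertT r key' empty_trie in
                   ret ((v, w) :: ch)
                 else
                   let* cs' := insert_childT cs in
                   ret (c :: cs')
           end)) ch in
    ret (Node (r :: stored) ch')
  else ret (Node (r :: stored) ch)).

Definition prefix_treeT (rs : seq round) : timed trie :=
  foldT (fun r u => insertT r (answer r) u) empty_trie rs.

(* The nonempty intervals among those into which [vs], sorted increasingly, cuts
   what lies between [lo] and the closed upper end [c]. *)
Fixpoint gapsT (lo : itv_bound R) (vs : seq R) (c : R) : timed (seq (interval R)) :=
  tick (match vs with
    | [::] =>
        let* ne := op (lo < BRight c)%O in
        ret (if ne then [:: Interval lo (BRight c)] else [::])
    | v :: vs' =>
        let* ne := op (lo < BLeft v)%O in
        let* rest := gapsT (BRight v) vs' c in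
        ret (if ne then Interval lo (BLeft v) :: rest else rest)
    end).

(* The pairs (u, I), the node u being given by its prefix [pi]; [caps] lists the
   upper ends of the coordinates that are not in [pi]. *)
Fixpoint cells_fromT caps pi (u : trie) : timed (seq (seq R * interval R)) :=
  tick (if caps is c :: caps' then
    let: Node _ ch := u in
    let* vs := mapT (fun w => ret w.1) ch in
    let* gaps := gapsT (BLeft 0) vs c in
    let* here := mapT (fun I => ret (pi, I)) gaps in
    let* below := flatmapT (fun w =>
      let* pi' := rconsT pi w.1 in
      cells_fromT caps' pi' w.2) ch in
    catT here below
  else ret [::]).

Definition cellsT inp : timed (seq (seq R * interval R)) :=
  let* u := prefix_treeT (rounds inp) in
  cells_fromT (caps_of inp) [::] u.

(* The value 0 is returned only if [qs] and [ys] coincide. *)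
Fixpoint tau_roundT (as_ qs ys : seq R) : timed R :=
  tick (match as_, qs, ys with
    | aj :: as', qj :: qs', yj :: ys' =>
        let* same := eqT yj qj in
        if same then tau_roundT as' qs' ys'
        else
          let* d := subT yj qj in
          let* p := mulT aj d in
          sgT p
    | _, _, _ => ret 0
    end).

Definition tauT inp (ys : seq R) : timed (seq R) :=
  mapT (fun r => tau_roundT (coef r) (answer r) ys) (rounds inp).

(* A box is the list of its sides [lo, hi]; it may be empty.  As coefficients are
   nonzero, s a_j (x_j - q_j) >= 0 bounds x_j below or above by q_j, according to
   the sign of s a_j. *)
Definition tightenT (s : R) r (box : seq (R * R)) : timed (seq (R * R)) :=
  let* aq := zipT (coef r) (answer r) in
  map2T (fun c side =>
    let* z := mulT s c.1 in
    let* above := ltT 0 z in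
    if above then let* lo := maxT side.1 c.2 in ret (lo, side.2)
    else let* hi := minT side.2 c.2 in ret (side.1, hi)) aq box.

Definition boxT inp sigma : timed (seq (R * R)) :=
  let* sides := mapT (fun c => ret (0, c)) (caps_of inp) in
  let* oriented := zipT sigma (rounds inp) in
  foldT (fun sr box => tightenT sr.1 sr.2 box) sides oriented.

(* A box with two points is infinite, hence is not covered by the answers. *)
Definition has_non_answerT inp (box : seq (R * R)) : timed bool :=
  let* nonempty := allT (fun side => leT side.1 side.2) box in
  if ~~ nonempty then ret false else
  let* thick := hasT (fun side => ltT side.1 side.2) box in
  if thick then ret true else
  let* corner := mapT (fun side => ret side.1) box in
  let* b := is_answerT corner (rounds inp) in
  ret (~~ b).

(* The steps whose realization is left open: picking a point of X(u, I), choosing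
   a point of R_sigma minus the answers, and testing GARP on a list of pairs
   (x^t, p^t).  See [implements] for their specification. *)
Record subroutines := Subroutines {
  pick_point  : instance -> seq R -> interval R -> timed (seq R);
  choose_peak : instance -> seq R -> timed (seq R);
  test_garp   : seq (seq R * seq R) -> timed bool
}.

(* A pattern may occur several times in the resulting list. *)
Definition omegaT (sub : subroutines) inp : timed (seq (seq R)) :=
  let* cells := cellsT inp in
  let* patterns := mapT (fun c =>
    let* y := pick_point sub inp c.1 c.2 in
    tauT inp y) cells in
  filterT (fun sigma =>
    let* box := boxT inp sigma in
    has_non_answerT inp box) patterns.

Definition orientT (s : R) r : timed (seq R * seq R) :=
  let* p := mapT (mulT s) (coef r) in
  ret (answer r, p).

(* The pair (q^i, sigma^i(y) a^i), or [None] if y does not belong to C^i. *)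
Definition orient_towardsT (ys : seq R) r : timed (option (seq R * seq R)) :=
  let* d := map2T subT ys (answer r) in
  let* p := map2T mulT (coef r) d in
  let* pos := allT (leT 0) p in
  if pos then let* xp := orientT 1 r in ret (Some xp) else
  let* neg := allT (fun z => leT z 0) p in
  if neg then let* xp := orientT (-1) r in ret (Some xp) else
  ret None.

Definition try_patternT (sub : subroutines) inp sigma : timed (option (seq R)) :=
  let* data := map2T orientT sigma (rounds inp) in
  let* ok := test_garp sub data in
  if ok then let* y := choose_peak sub inp sigma in ret (Some y)
  else ret None.

Definition try_answerT (sub : subroutines) inp (ys : seq R) : timed (option (seq R)) :=
  let* others := filterT (fun r =>
    let* same := eqvT (answer r) ys in ret (~~ same)) (rounds inp) in
  let* oriented := mapT (orient_towardsT ys) others in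
  let* in_cones := allT (fun o => ret (isSome o)) oriented in
  if ~~ in_cones then ret None else
  let* data := flatmapT (fun o => ret (seq_of_opt o)) oriented in
  let* ok := test_garp sub data in
  ret (if ok then Some ys else None).

(* [Some y] stands for the answer "peak-oriented rationalizable with peak y", and
   [None] for the answer "not peak-oriented rationalizable". *)
Definition algorithm (sub : subroutines) inp : timed (option (seq R)) :=
  let* omega := omegaT sub inp in
  let* found := find_someT (try_patternT sub inp) omega in
  if found is Some y then ret (Some y) else
  find_someT (fun r => try_answerT sub inp (answer r)) (rounds inp).

(* Belongs to the interval if that is one of those produced by [gapsT]. *)
Definition itv_pointT I : timed R :=
  match I with
  | Interval (BLeft l) _ => ret l
  | Interval _ (BRight h) => ret h
  | Interval (BRight l) (BLeft h) => let* s := addT l h in divT s 2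
  | _ => ret 0
  end.

Fixpoint fillT pi v caps : timed (seq R) :=
  tick (match caps, pi with
    | [::], _ => ret [::]
    | _ :: caps', x :: pi' => let* ys := fillT pi' v caps' in ret (x :: ys)
    | _ :: caps', [::] =>
        let* zeros := mapT (fun=> ret 0) caps' in ret (v :: zeros)
    end).

Definition std_pick inp pi I : timed (seq R) :=
  let* v := itv_pointT I in
  fillT pi v (caps_of inp).

(* Tries lo + (hi - lo) / k for consecutive values of [k], one more of them than
   [fuel] has elements.  In a box with two points the candidates are distinct, so
   that one of them is not an answer if [fuel] lists all rounds. *)
Fixpoint searchT inp (box : seq (R * R)) (k : R) (fuel : seq round) : timed (seq R) :=
  tick (
    let* y := mapT (fun side =>
      let* w := subT side.2 side.1 in
      let* d := divT w k in
      addT side.1 d) box in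
    let* b := is_answerT y (rounds inp) in
    if ~~ b then ret y else
    if fuel is _ :: fuel' then
      let* k' := addT k 1 in searchT inp box k' fuel'
    else ret y).

Definition std_choose inp sigma : timed (seq R) :=
  let* box := boxT inp sigma in
  searchT inp box 1 (rounds inp).

(* p^s . (x^s - x^t) *)
Definition gainT (s t : seq R * seq R) : timed R :=
  let* d := map2T subT s.1 t.1 in dotT s.2 d.

Definition closure_stepT (k : nat) (W : seq (seq bool)) : timed (seq (seq bool)) :=
  let* rowk := nthT [::] W k in
  mapT (fun row =>
    let* via := nthT false row k in
    if via then map2T (fun b c => ret (b || c)) row rowk else ret row) W.

(* Warshall's algorithm: makes the indices from [k] on, one for each element of
   [fuel], available as intermediate points. *)
Fixpoint closureT (T : Type) (fuel : seq T) (k : nat) (W : seq (seq bool)) :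
    timed (seq (seq bool)) :=
  tick (if fuel is _ :: fuel' then
    let* W' := closure_stepT k W in closureT fuel' k.+1 W'
  else ret W).

(* GARP fails iff p^t . (x^t - x^s) > 0 for some pair (s, t) in the transitive
   closure of the relation p^s . (x^s - x^t) >= 0. *)
Definition std_garp (data : seq (seq R * seq R)) : timed bool :=
  let* weak := mapT (fun s => mapT (fun t =>
    let* g := gainT s t in leT 0 g) data) data in
  let* strict := mapT (fun s => mapT (fun t =>
    let* g := gainT t s in ltT 0 g) data) data in
  let* weak' := closureT data 0 weak in
  let* clash := map2T (fun row row' =>
    let* c := map2T (fun b b' => ret (b && b')) row row' in
    hasT (fun b => ret b) c) weak' strict in
  let* bad := hasT (fun b => ret b) clash in
  ret (~~ bad).

Definition std_subroutines : subroutines :=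
  Subroutines std_pick std_choose std_garp.

End Algorithm.

Arguments std_subroutines : clear implicits.

Definition coords (R : realType) (k : nat) (x : 'rV[R]_k) : seq R :=
  [seq x 0 j | j <- enum 'I_k].

Definition encode (R : realType) (m n : nat) (D : survey R m n) : instance :=
  Instance (coords (cap D))
           [seq Round (coords (a D i)) (coords (q D i)) | i <- enum 'I_n].

(* X(u, I), where the node u has prefix [pi]. *)
Definition cell (R : realType) (m n : nat) (D : survey R m n)
    (pi : seq R) (I : interval R) : set 'rV[R]_m :=
  [set y | [/\ X D y, take (size pi) (coords y) = pi &
               nth 0 (coords y) (size pi) \in I]].

(* On the data that can arise from [D], the subroutines [sub] meet their
   specification and each of their calls takes at most [k] steps. *)
Record implements (R : realType) (m n : nat) (D : survey R m n)
    (sub : subroutines) (k : nat) : Prop := Implements {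
  pick_point_ok : forall pi I, (pi, I) \in (cellsT (encode D)).1 ->
    let c := pick_point sub (encode D) pi I in
    (exists2 y, cell D pi I y & c.1 = coords y) /\ (c.2 <= k)%N;
  choose_peak_ok : forall sigma : 'rV[R]_n,
    (forall i, sigma 0 i = 1 \/ sigma 0 i = -1) ->
    (orthant_box D sigma `\` answers D) !=set0 ->
    let c := choose_peak sub (encode D) (coords sigma) in
    (exists2 y, (orthant_box D sigma `\` answers D) y & c.1 = coords y) /\
    (c.2 <= k)%N;
  test_garp_ok : forall (l : nat) (x p : 'I_l -> 'rV[R]_m), (l <= n)%N ->
    let c := test_garp sub [seq (coords (x t), coords (p t)) | t <- enum 'I_l] in
    (c.1 <-> GARP x p) /\ (c.2 <= k)%N
}.

(* Main.v *)
Require Import Defs.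
From HB Require Import structures.
From mathcomp Require Import all_boot all_order all_algebra.
From mathcomp Require Import all_classical all_reals all_analysis.
From mathcomp Require Import ring lra zify.
Import numFieldNormedType.Exports.
Import Order.TTheory GRing.Theory Num.Theory.

Set Implicit Arguments.
Unset Strict Implicit.
Unset Printing Implicit Defensive.

Local Open Scope classical_set_scope.
Local Open Scope ring_scope.

(** The algorithm decides rationalizability because, for a fixed peak [y], being
    rationalizable with peak [y] is an acyclicity property that GARP tests.

    If the data are rationalized with peak [y], the sign of the multiplier of a
    round whose answer is not [y] orients this round toward [y]
    ([rationalizable_oriented]); being supergradients, the oriented coefficients
    turn a GARP cycle into a utility decrease around a cycle
    ([rationalizable_GARP]).  Conversely, GARP for the oriented rounds yields
    Afriat numbers, for which there is an explicit formula ([afriat]), and the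
    minimum of [0] and of the Afriat affine functions is a utility that is maximal
    at [y], because every oriented round strictly favours [y] over its own answer
    ([GARP_rationalizable]).  So only the orientation of the rounds toward [y]
    matters, and the algorithm has to try one peak per pattern of orientations,
    besides the answers themselves.

    The prefix tree finds all patterns of points that are not answers.  Such a
    point agrees with the tree up to some node and then falls into a gap between
    the children of that node, that is, into one of the enumerated cells
    ([cells_cover]).  On a cell, the sign at the first coordinate that differs from
    an answer is constant ([tau_round_cell]), and in a round oriented toward the
    point this sign is the orientation ([tau_round_oriented]).  So the pattern
    computed at an arbitrary point of the cell is the one sought ([mem_omega]).
    There are fewer than twice as many cells as nodes, hence polynomially many.

    Values and running times are proved together, by a Hoare-style judgement whose
    bounds mirror the structure of the programs.  That these bounds are polynomial
    is checked only at the end, from closure of the class of polynomially bounded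
    functions under sums and products. *)

(** * Afriat inequalities *)

(** Finitely many numbers leave a gap [del] above zero and stay above some [- Del].
    The ratio of the two sets the growth rate of the utilities below. *)
Lemma finite_scales (R : realFieldType) (S : finType) (d : S -> S -> R) (e : S -> R) :
  (forall s, 0 < e s) ->
  exists del Del : R, [/\ 0 < del, 0 < Del, forall s, del <= e s,
    forall s t, 0 < d s t -> del <= d s t & forall s t, - Del <= d s t].
Proof.
move=> e0.
pose w := \big[Num.min/1]_s e s.
pose del := \big[Num.min/w]_(st : S * S | 0 < d st.1 st.2) d st.1 st.2.
have del_w : del <= w by exact: bigmin_le_id.
exists del, (1 + \sum_(st : S * S) `|d st.1 st.2|); split.
- by apply: lt_bigmin => //; apply: lt_bigmin.
- by rewrite ltr_pwDl// sumr_ge0.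
- by move=> s; apply: (le_trans del_w); exact: bigmin_le.
- by move=> s t dst; exact: (@bigmin_le_cond _ _ _ w (s, t) (fun st => 0 < d st.1 st.2)).
- move=> s t; rewrite lerNl (bigD1 (s, t))//=.
  apply: (le_trans (ler_norm _)); rewrite normrN.
  by rewrite addrCA lerDl addr_ge0// sumr_ge0.
Qed.

(** Let [r s] count the indices that [s] is revealed at least as good as.  From [s]
    to [t] the rank does not increase if [d s t] is at most zero, and it decreases
    if [d s t] is negative, by acyclicity.  The disutilities [K ^ (N - r s)], where
    [N] is the number of indices, grow so fast as the rank falls that a multiplier
    of the order of the disutility of [s] serves all [t] at once: for a positive
    [d s t] it lifts the bound to zero at least, and for a negative one the disutility of
    [t] is still larger.  The numbers [e s] are entries toward one more
    alternative, whose utility is zero. *)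
Lemma afriat (R : realFieldType) (S : finType) (d : S -> S -> R) (e : S -> R) :
  (forall s, 0 < e s) ->
  (forall s t, connect (fun s t => d s t <= 0) s t -> 0 <= d t s) ->
  exists U lam : S -> R, [/\ forall s, U s <= 0, forall s, 0 < lam s,
    forall s t, U t <= U s + lam s * d s t & forall s, 0 <= U s + lam s * e s].
Proof.
move=> e0 acyclic; pose rel s t := d s t <= 0.
have [del [Del [del0 Del0 dele deld Deld]]] := finite_scales d e0.
pose r s := #|connect rel s|; pose K := 1 + Del / del.
have K1 : 1 <= K by rewrite lerDl divr_ge0// ltW.
have K0 : 0 < K by exact: lt_le_trans K1.
pose h s := K ^+ (#|S| - r s); have h0 s : 0 < h s by rewrite exprn_gt0.
have h_scale s x : del <= x -> h s <= h s / del * x.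
  move=> dx; rewrite -mulrA ler_peMr ?(ltW (h0 s))//.
  by rewrite mulrC ler_pdivlMr// mul1r.
have r_mono s t : d s t <= 0 -> (r t <= r s)%N.
  move=> dst; apply: subset_leq_card; apply/fintype.subsetP => x.
  by rewrite !unfold_in => /(connect_trans (connect1 (e := rel) dst)).
have r_strict s t : d s t < 0 -> (r t < r s)%N.
  move=> dst; rewrite ltn_neqAle r_mono ?(ltW dst)// andbT.
  apply/eqP => rts; have sub : connect rel t \subset connect rel s.
    apply/fintype.subsetP => x; rewrite !unfold_in.
    by apply: (connect_trans (connect1 (e := rel) _)); exact: ltW.
  have : s \in connect rel t by rewrite (subset_cardP rts sub); exact: connect0.
  by move/acyclic; rewrite leNgt dst.
exists (fun s => - h s), (fun s => h s / del); split => [s|s|s t|s].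
- by rewrite oppr_le0 ltW.
- by rewrite divr_gt0.
- have [dlt|dgt|deq] := ltgtP (d s t) 0.
  + have rr := r_strict _ _ dlt.
    have hst : h s * K <= h t.
      rewrite -exprSr; apply: ler_weXn2l => //.
      have : (r s <= #|S|)%N by exact: max_card.
      by lia.
    apply: (@le_trans _ _ (- (h s * K))); first by rewrite lerN2.
    rewrite /K mulrDr mulr1 opprD lerD2l -lerN2 opprK -mulrN mulrCA -mulrA mulrCA.
    rewrite ler_pM2l// mulrC -subr_ge0 -mulrBl mulr_ge0 ?invr_ge0 ?(ltW del0)//.
    by rewrite subr_ge0 lerNl.
  + apply: (@le_trans _ _ 0); first by rewrite oppr_le0 ltW.
    by rewrite addrC subr_ge0 h_scale// deld.
  + rewrite deq mulr0 addr0 lerN2; apply: ler_weXn2l => //.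
    by have := r_mono s t; rewrite deq lexx => /(_ isT); lia.
- by rewrite addrC subr_ge0 h_scale.
Qed.

(** * Peak-oriented rationalizability as acyclicity *)

Section InnerProduct.
Context (R : realType) (m : nat).
Implicit Types (x y z p : 'rV[R]_m) (k : R).

Lemma dotB p x y : dot p (x - y) = dot p x - dot p y.
Proof. by rewrite /dot -sumrB; apply: eq_bigr => j _; rewrite !mxE mulrBr. Qed.

Lemma dotD p x y : dot p (x + y) = dot p x + dot p y.
Proof. by rewrite /dot -big_split; apply: eq_bigr => j _; rewrite !mxE mulrDr. Qed.

Lemma dotZr p k x : dot p (k *: x) = k * dot p x.
Proof. by rewrite /dot mulr_sumr; apply: eq_bigr => j _; rewrite !mxE mulrCA. Qed.

Lemma dotZl p k x : dot (k *: p) x = k * dot p x.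
Proof. by rewrite /dot mulr_sumr; apply: eq_bigr => j _; rewrite !mxE mulrA. Qed.

Lemma dot_continuous p : continuous (dot p).
Proof.
apply: (@continuous_big R _ _ 0 predT (@add_continuous R^o) _ _
  (fun j x => p 0 j * x 0 j)) => j _ x.
by apply: continuousM; [exact: cst_continuous|exact: coord_continuous].
Qed.

End InnerProduct.

Lemma affine_continuous (R : realType) (m : nat) (k : R) (p z : 'rV[R]_m) :
  continuous (fun x : 'rV[R]_m => k + dot p (x - z)).
Proof.
have shift (T : topologicalType) (f : T -> R) l :
    continuous f -> continuous (fun x => k + (f x - l)).
  move=> fc x; apply: cvgD; first exact: cvg_cst.
  by apply: cvgB; [exact: fc|exact: cvg_cst].
rewrite (_ : (fun _ => _) = (fun x => k + (dot p x - dot p z))).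
  exact: shift (@dot_continuous _ _ p).
by apply/funext => x; rewrite dotB.
Qed.

Section MinimumOfAffine.
Context (R : realType) (m : nat) (S : finType).
Context (c : S -> R) (p z : S -> 'rV[R]_m).

(** Including [0] in the minimum makes any point at which all the affine functions
    are nonnegative a global maximum. *)
Definition min_affine (x : 'rV[R]_m) : R :=
  \big[Num.min/0]_s (c s + dot (p s) (x - z s)).

Lemma min_affine_continuous : continuous min_affine.
Proof.
rewrite /min_affine; apply: (@continuous_big R _ _ 0 predT (@min_continuous _ R) _ _
  (fun s (x : 'rV[R]_m) => c s + dot (p s) (x - z s))) => s _.
exact: affine_continuous.
Qed.

Lemma min_affine_concave n (D : survey R m n) : concave D min_affine.
Proof.
move=> t x y _ _; rewrite !convRE -[conv t x y]/(t%:num *: x + (1 - t%:num) *: y) /unstable.onem.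
rewrite !mulrN -opprD lerN2.
have t0 : 0 <= t%:num by [].
have t1 : 0 <= (1 - t%:num) by rewrite subr_ge0.
apply: le_bigmin => [|s _].
  by rewrite -[leRHS]addr0 lerD// mulr_ge0_le0// bigmin_le_id.
have -> : c s + dot (p s) (t%:num *: x + (1 - t%:num) *: y - z s) =
    t%:num * (c s + dot (p s) (x - z s)) + (1 - t%:num) * (c s + dot (p s) (y - z s)).
  rewrite !dotB dotD !dotZr; ring.
by rewrite lerD// ler_wpM2l// bigmin_le.
Qed.

End MinimumOfAffine.

Definition signed (R : nzRingType) (s : R) := s = 1 \/ s = -1.

Lemma signed_neq0 (R : nzRingType) (s : R) : signed s -> s != 0.
Proof. by case=> ->; rewrite ?oppr_eq0 oner_eq0. Qed.

Section Orientation.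
Context (R : realType) (m n : nat) (D : survey R m n).
Implicit Types (y : 'rV[R]_m) (s : R) (i : 'I_n).

(** The orthants O^i_+ (for [s = 1]) and O^i_- (for [s = -1]), up to the bounds of
    [X].  With the sign as a factor, both cases are handled at once. *)
Definition oriented i s y := forall j, 0 <= s * a D i 0 j * (y 0 j - q D i 0 j).

(** A vanishing sum of nonnegative terms has vanishing terms, and since no
    coefficient is zero, [y] is then [q D i]. *)
Lemma oriented_dot i s y :
  (forall j, a D i 0 j != 0) -> s != 0 -> oriented i s y -> y != q D i ->
  0 < dot (s *: a D i) (y - q D i).
Proof.
move=> a0 s0 oy; apply: contra_neqT => dot_le0.
have dotE : dot (s *: a D i) (y - q D i) = \sum_j s * a D i 0 j * (y 0 j - q D i 0 j).
  by apply: eq_bigr => j _; rewrite !mxE.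
have /psumr_eq0P dot0 : forall j, true -> 0 <= s * a D i 0 j * (y 0 j - q D i 0 j).
  by move=> j _; exact: oy.
apply/rowP => j; apply/eqP; rewrite -subr_eq0.
have : s * a D i 0 j * (y 0 j - q D i 0 j) = 0.
  apply: dot0 => //; apply/eqP; rewrite -dotE eq_le leNgt dot_le0/=.
  by rewrite dotE sumr_ge0.
by move/eqP; rewrite !mulf_eq0 (negPf s0) (negPf (a0 j)).
Qed.

(** The sign of the multiplier orients the round; the multiplier is not zero because
    its product with [y - q D i] is positive. *)
Lemma rationalizable_oriented y : rationalizable_with_peak D y ->
  X D y /\ exists s : 'I_n -> R,
    forall i, signed (s i) /\ (y != q D i -> oriented i (s i) y).
Proof.
move=> [u [lam [[Xy _ _] [_ _ _ lamP lamS]]]]; split=> //.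
exists (fun i => if 0 < lam i then 1 else -1) => i; split.
  by case: ifP => _; [left|right].
move=> yq j; have lam0 : lam i != 0.
  by apply: contraTneq (lamS i (fun e => negP yq (introT eqP (esym e)))) => ->;
    rewrite scale0r -(scale0r 0) dotZl mul0r ltxx.
have -> : (if 0 < lam i then 1 else -1) = lam i / `|lam i|.
  case: ltgtP lam0 => // [l0|l0] _; rewrite ?(gtr0_norm l0) ?(ltr0_norm l0).
    by rewrite divff ?gt_eqF.
  by rewrite invrN mulrN divff ?lt_eqF.
rewrite (_ : _ * _ = lam i * a D i 0 j * (y 0 j - q D i 0 j) / `|lam i|); last by ring.
by rewrite divr_ge0.
Qed.

(** The map [f] lists the rounds whose answer is not [y].  It is the identity when
    [y] is not an answer, and the enumeration of a sublist of the rounds otherwise. *)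
Section Revealed.
Context (S : finType) (f : S -> 'I_n) (s : 'I_n -> R) (y : 'rV[R]_m).
Hypothesis a0 : forall i j, a D i 0 j != 0.
Hypothesis qB : forall i, budget D i (q D i).
Hypothesis Xy : X D y.
Hypothesis fP : forall i, (q D i != y) = (i \in codom f).
Hypothesis sP : forall i, signed (s i).
Hypothesis sy : forall i, y != q D i -> oriented i (s i) y.

(** Moving along revealed preferences never raises a rationalizing utility, and it
    lowers it where the gain is positive, because the multipliers agree with the
    signs [s] up to positive factors. *)
Lemma rationalizable_GARP :
  rationalizable_with_peak D y -> GARP (q D \o f) (fun t => s (f t) *: a D (f t)).
Proof.
move=> [u [lam [[_ _ _] [_ _ sup lamP lamS]]]].
have lam_s t : exists2 k, 0 < k & lam (f t) = k * s (f t).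
  have qfy : q D (f t) != y by rewrite fP codom_f.
  have dotl := lamS _ (elimN eqP qfy).
  have := oriented_dot (a0 (f t)) (signed_neq0 (sP (f t))).
  move=> /(_ y); rewrite eq_sym => /(_ (sy _) qfy); rewrite eq_sym => /(_ qfy).
  move: dotl; rewrite !dotZl => dotl dots.
  have s2 : s (f t) * s (f t) = 1 by case: (sP (f t)) => ->; rewrite ?mulrNN mulr1.
  exists (lam (f t) * s (f t)); last by rewrite -mulrA s2 mulr1.
  have := mulr_gt0 dotl dots.
  rewrite mulrACA pmulr_lgt0// -expr2 exprn_even_gt0//=.
  by apply: contraTneq dotl => ->; rewrite mulr0 ltxx.
have drop t t' k : 0 < k -> lam (f t) = k * s (f t) ->
    u (q D (f t')) <= u (q D (f t)) -
      k * dot (s (f t) *: a D (f t)) (q D (f t) - q D (f t')).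
  move=> k0 lamE; apply: (le_trans (sup (f t) _ (qB _).1)).
  by rewrite lerD2l lamE -scalerA (dotZl _ k) !dotB -mulrN opprB.
move=> [t1 [ts [pth gain]]].
have weak : u (q D (f (last t1 ts))) <= u (q D (f t1)).
  elim: ts t1 pth {gain} => [|t' ts IH] t //= /andP[g pth].
  apply: (le_trans (IH _ pth)); have [k k0 lamE] := lam_s t.
  apply: (le_trans (drop _ t' k k0 lamE)).
  by rewrite gerBl mulr_ge0// ltW.
have [k k0 lamE] := lam_s (last t1 ts).
have := drop _ t1 k k0 lamE; rewrite leNgt => /negP; apply.
apply: lt_le_trans weak; by rewrite ltrBlDr ltrDl mulr_gt0.
Qed.

(** The utility is the minimum of [0] and of the Afriat affine functions.  At an
    answer other than [y] the minimum is attained by the function of its own round,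
    which provides the supergradient.  At [y] it is [0], the global maximum, and the
    multiplier [0] serves the rounds whose answer is [y]. *)
Lemma GARP_rationalizable :
  GARP (q D \o f) (fun t => s (f t) *: a D (f t)) -> rationalizable_with_peak D y.
Proof.
pose p t := s (f t) *: a D (f t); move=> garp.
have [|t0 t' path_tt|U [lam [U0 lam0 UU Uy]]] := @afriat R S
    (fun t t' => dot (p t) (q D (f t') - q D (f t))) (fun t => dot (p t) (y - q D (f t))).
- move=> t; have qfy : y != q D (f t) by rewrite eq_sym fP codom_f.
  by apply: oriented_dot => //; [exact: signed_neq0|exact: sy].
- rewrite leNgt; apply/negP => neg; apply: garp.
  have /connectP[ts pth lst] := path_tt; exists t0, ts; split; last first.
    by rewrite -lst /= dotB subr_gt0 -subr_lt0 -dotB.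
  apply: sub_path pth => t1 t2 /=.
  by rewrite !dotB subr_le0 subr_ge0.
pose u := min_affine U (fun t => lam t *: p t) (q D \o f).
pose l i := if [pick t | f t == i] is Some t then lam t * s i else 0.
have u_le t x : u x <= U t + dot (lam t *: p t) (x - q D (f t)) by exact: bigmin_le.
have u_q t : u (q D (f t)) = U t.
  apply/le_anti/andP; split.
    by apply: (le_trans (u_le t _)); rewrite dotB subrr addr0.
  by apply: le_bigmin => // t' _; rewrite dotZl.
have u_y : u y = 0.
  apply/le_anti/andP; split; first exact: bigmin_le_id.
  by apply: le_bigmin => // t _; rewrite dotZl.
have u_le0 x : u x <= 0 by exact: bigmin_le_id.
have lE i : (exists2 t, f t = i & l i *: a D i = lam t *: p t) \/ (l i = 0 /\ q D i = y).
  rewrite /l; case: pickP => [t /eqP <-|nof].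
    by left; exists t => //; rewrite /p scalerA.
  right; split => //; apply/eqP/negPn; rewrite fP; apply/negP => /codomP[t it].
  by have := nof t; rewrite it eqxx.
have l0 i : 0 <= l i / s i.
  rewrite /l; case: pickP => [t _|_]; last by rewrite mul0r.
  by rewrite mulfK ?signed_neq0// ltW.
have sup i : superdiff D u (q D i) (l i *: a D i).
  move=> x Xx; case: (lE i) => [[t <- ->]|[-> ->]]; first by rewrite u_q.
  by rewrite u_y scale0r -(scale0r 0) dotZl mul0r addr0.
exists u, l; split; first split => //.
- by apply: continuous_subspaceT; exact: min_affine_continuous.
- exact: min_affine_concave.
split => //.
- by split => // x _; rewrite u_y.
- move=> i; split; first by [].
  move=> x [Xx ax].
  apply: (le_trans (sup i x Xx)); rewrite dotZl dotB.
  have [_ ->] := qB i; rewrite ax subrr mulr0 addr0//.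
- move=> i j; have [l_eq0|l_neq0] := eqVneq (l i) 0; first by rewrite l_eq0 !mul0r.
  have -> : l i * a D i 0 j * (y 0 j - q D i 0 j) =
      l i / s i * (s i * a D i 0 j * (y 0 j - q D i 0 j)).
    by field; rewrite signed_neq0.
  rewrite mulr_ge0 ?l0//; apply: sy.
  apply: contraTneq l_neq0 => yq; rewrite negbK /l; case: pickP => // t /eqP ft.
  by have := fP i; rewrite -yq eqxx -ft codom_f.
- move=> i /eqP qy; case: (lE i) => [[t ft ->]|[_ qy']]; last by rewrite qy' eqxx in qy.
  rewrite dotZl mulr_gt0// -ft /p; apply: oriented_dot => //.
  + exact: signed_neq0.
  + by apply: sy; rewrite eq_sym ft.
  + by rewrite eq_sym ft.
Qed.

End Revealed.

End Orientation.

(** * Running times *)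

(** A Hoare-style judgement, with one rule per construct of the timed programs, so
    that a value and a running time are established by the same derivation. *)
Definition runs (A : Type) (c : timed A) (v : A) (b : nat) : Prop :=
  c.1 = v /\ (c.2 <= b)%N.

(** The cost of a traversal of [k] elements with [b] steps for each: moving to the
    next element costs one step, and so does finding the end of the list. *)
Definition loop (k b : nat) : nat := (k * b.+1).+1.

Lemma leq_loop k k' b b' : (k <= k')%N -> (b <= b')%N -> (loop k b <= loop k' b')%N.
Proof. by move=> kk bb; rewrite ltnS leq_mul. Qed.

Lemma loopS k b : loop k.+1 b = (b + loop k b).+1.
Proof. by rewrite /loop mulSn addSn addnS. Qed.

Section Judgement.
Context {A B : Type}.
Implicit Types (c : timed A) (v : A) (b : nat).

Lemma runs_weak b b' c v : (b <= b')%N -> runs c v b -> runs c v b'.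
Proof. by move=> bb [? /leq_trans]; split; auto. Qed.

Lemma runs_ret v : runs (ret v) v 0. Proof. by []. Qed.

Lemma runs_op v : runs (op v) v 1. Proof. by []. Qed.

Lemma runs_tick c v b : runs c v b -> runs (tick c) v b.+1.
Proof. by case. Qed.

Lemma runs_bind c v b (f : A -> timed B) w b' :
  runs c v b -> runs (f v) w b' -> runs (bind c f) w (b + b').
Proof. by move=> [<- cb] [fw fb]; split=> //; rewrite leq_add. Qed.

End Judgement.

Section Traversals.
Context {T : Type} {A B C : Type}.
Implicit Types (s : seq T) (b k : nat).

(** Accumulators are lists in the programs, but functions are easier to reason about:
    [rep] turns a state of the latter kind into one of the former. *)
Lemma runs_foldT (S : Type) (rep : S -> B) (f : A -> B -> timed B) (h : T -> A)
    (g : T -> S -> S) t0 s k b :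
  (size s <= k)%N -> (forall x t, List.In x s -> runs (f (h x) (rep t)) (rep (g x t)) b) ->
  runs (foldT f (rep t0) (map h s)) (rep (foldr g t0 s)) (loop k b).
Proof.
elim: s k => [|x s IH] [|k]//= sk fg; rewrite loopS addnC.
apply/runs_tick/(runs_bind (v := rep (foldr g t0 s))).
  by apply: IH => // y *; apply: fg; right.
by apply: fg; left.
Qed.

Lemma runs_foldrT (f : A -> B -> timed B) (h : T -> A) (g : T -> B -> B) r0 s k b :
  (size s <= k)%N -> (forall x r, List.In x s -> runs (f (h x) r) (g x r) b) ->
  runs (foldT f r0 (map h s)) (foldr g r0 s) (loop k b).
Proof. exact: (runs_foldT (rep := id)). Qed.

End Traversals.

Arguments runs_foldT {T A B S} rep {f h g t0 s k b}.
Arguments runs_foldrT {T A B f h g r0 s k b}.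

Section MoreTraversals.
Context {T : Type} {A B C : Type}.
Implicit Types (s : seq T) (b k : nat).

Lemma runs_mapT (f : A -> timed B) (h : T -> A) (g : T -> B) s k b :
  (size s <= k)%N -> (forall x, List.In x s -> runs (f (h x)) (g x) b) ->
  runs (mapT f (map h s)) (map g s) (loop k b).
Proof.
rewrite (_ : map g s = foldr (fun x r => g x :: r) [::] s); last by elim: s => //= ? ? ->.
move=> sk fg; apply: runs_foldrT => // x t xs; rewrite -[b]addn0.
by apply: runs_bind; [exact: fg|exact: runs_ret].
Qed.

Lemma runs_filterT (p : A -> timed bool) (h : T -> A) (g : pred T) s k b :
  (size s <= k)%N -> (forall x, List.In x s -> runs (p (h x)) (g x) b) ->
  runs (Defs.filterT p (map h s)) [seq h x | x <- s & g x] (loop k b).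
Proof.
move=> sk pg; rewrite (_ : [seq h x | x <- s & g x] =
    foldr (fun x r => if g x then h x :: r else r) [::] s).
  apply: runs_foldrT => // x t xs; rewrite -[b]addn0.
  by apply: runs_bind; [exact: pg|exact: runs_ret].
by elim: s {sk pg} => //= x s <-; case: (g x).
Qed.

Lemma runs_allT (p : A -> timed bool) (h : T -> A) (g : pred T) s k b :
  (size s <= k)%N -> (forall x, List.In x s -> runs (p (h x)) (g x) b) ->
  runs (Defs.allT p (map h s)) (all g s) (loop k b).
Proof.
rewrite (_ : all g s = foldr (fun x r => g x && r) true s); last by elim: s => //= ? ? ->.
move=> sk pg; apply: runs_foldrT => // x t xs; rewrite -[b]addn0.
by apply: runs_bind; [exact: pg|exact: runs_ret].
Qed.

Lemma runs_hasT (p : A -> timed bool) (h : T -> A) (g : pred T) s k b :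
  (size s <= k)%N -> (forall x, List.In x s -> runs (p (h x)) (g x) b) ->
  runs (Defs.hasT p (map h s)) (has g s) (loop k b).
Proof.
rewrite (_ : has g s = foldr (fun x r => g x || r) false s); last by elim: s => //= ? ? ->.
move=> sk pg; apply: runs_foldrT => // x t xs; rewrite -[b]addn0.
by apply: runs_bind; [exact: pg|exact: runs_ret].
Qed.

Lemma runs_map2T (f : A -> B -> timed C) (h : T -> A) (h' : T -> B) (g : T -> C) s k b :
  (size s <= k)%N -> (forall x, List.In x s -> runs (f (h x) (h' x)) (g x) b) ->
  runs (map2T f (map h s) (map h' s)) (map g s) (loop k b).
Proof.
elim: s k => [|x s IH] [|k]//= sk fg; rewrite loopS.
apply/runs_tick/runs_bind; first by apply: fg; left.
rewrite -[X in runs _ _ X]addn0; apply: runs_bind; last exact: runs_ret.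
by apply: IH => // y *; apply: fg; right.
Qed.

Lemma runs_find_someT (f : A -> timed (option B)) (h : T -> A) (g : T -> option B) s k b :
  (size s <= k)%N -> (forall x, List.In x s -> runs (f (h x)) (g x) b) ->
  runs (find_someT f (map h s)) (ohead (pmap g s)) (loop k b).
Proof.
elim: s k => [|x s IH] [|k]//= sk fg; rewrite loopS.
apply/runs_tick/runs_bind; first by apply: fg; left.
case: (g x) => [y|] /=; first exact: (runs_weak (leq0n _) (runs_ret _)).
by apply: IH => // y *; apply: fg; right.
Qed.

End MoreTraversals.

Lemma runs_zipT (T : Type) (A B : Type) (h : T -> A) (h' : T -> B) s k :
  (size s <= k)%N -> runs (zipT (map h s) (map h' s)) (map (fun x => (h x, h' x)) s) (loop k 0).
Proof. by move=> sk; apply: runs_map2T => // x _; exact: runs_ret. Qed.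

Lemma catT_val (A : Type) (s t : seq A) : (catT s t).1 = s ++ t.
Proof. by elim: s => //= x s <-. Qed.

Lemma catT_cost (A : Type) (s t : seq A) : (catT s t).2 = (size s).+1.
Proof. by elim: s => //= x s; rewrite /catT /= addn0 => ->. Qed.

Lemma mapT_val (A B : Type) (f : A -> B) (s : seq A) :
  mapT (fun t => ret (f t)) s = (map f s, (size s).+1).
Proof. by rewrite /mapT; elim: s => // t s /= ->; rewrite /tick /bind /= !addn0. Qed.

Lemma flatmapT_val (A B : Type) (f : A -> timed (seq B)) (s : seq A) :
  (flatmapT f s).1 = flatten [seq (f t).1 | t <- s].
Proof. by rewrite /flatmapT; elim: s => //= x s IH; rewrite catT_val IH. Qed.

Lemma flatmapT_cost (A B : Type) (f : A -> timed (seq B)) (s : seq A) :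
  (flatmapT f s).2 = (sumn [seq ((f t).2 + size (f t).1).+2 | t <- s]).+1.
Proof.
by rewrite /flatmapT; elim: s => //= x s ->; rewrite catT_cost; lia.
Qed.

Lemma runs_catT (A : Type) (s t : seq A) : runs (catT s t) (s ++ t) (loop (size s) 0).
Proof. by split; [rewrite catT_val|rewrite catT_cost /loop muln1]. Qed.

(** The summand [loop l 0] pays for the concatenation. *)
Lemma runs_flatmapT (T : Type) (A B : Type) (f : A -> timed (seq B)) (h : T -> A)
    (g : T -> seq B) s k b l :
  (size s <= k)%N -> (forall x, List.In x s -> runs (f (h x)) (g x) b /\ (size (g x) <= l)%N) ->
  runs (flatmapT f (map h s)) (flatten (map g s)) (loop k (b + loop l 0)).
Proof.
move=> sk fg; rewrite (_ : flatten _ = foldr (fun x r => g x ++ r) [::] s).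
  apply: runs_foldrT => // x t xs; have [fx gk] := fg x xs.
  apply: runs_bind fx _; apply: runs_weak (runs_catT _ _).
  exact: leq_loop.
by elim: s {sk fg} => //= x s ->.
Qed.

Lemma runs_nthT (A : Type) (x0 : A) s k : runs (nthT x0 s k) (nth x0 s k) (loop (size s) 0).
Proof.
elim: s k => [|x s IH] [|k] //=; have [<- le] := IH k.
by split=> //=; move: le; rewrite /loop; lia.
Qed.

Lemma leq_enum_ord m : (size (enum 'I_m) <= m)%N.
Proof. by rewrite size_enum_ord. Qed.

Section Vectors.
Context (R : realType) (m : nat).
Implicit Types v w : 'rV[R]_m.

Lemma runs_dotT v w :
  runs (dotT (coords v) (coords w)) (dot v w) (loop m 1 + loop m 1).
Proof.
apply: runs_bind.
  by apply: (runs_map2T (leq_enum_ord m)) => j _; exact: runs_op.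
rewrite (_ : dot v w = foldr (fun j z => v 0 j * w 0 j + z) 0 (enum 'I_m)).
  by apply: (runs_foldrT (leq_enum_ord m)) => j z _; exact: runs_op.
rewrite /dot -big_enum /=; elim: (enum 'I_m) => [|j l IH]; first by rewrite big_nil.
by rewrite big_cons IH.
Qed.

Lemma coords_inj : injective (@coords R m).
Proof.
move=> v w /eq_in_map vw; apply/rowP => j.
by apply: vw; rewrite mem_enum.
Qed.

Lemma runs_eqvT v w : runs (eqvT (coords v) (coords w)) (v == w) (loop m 1 + loop m 0).
Proof.
apply: runs_bind.
  by apply: (runs_map2T (leq_enum_ord m)) => j _; exact: runs_op.
rewrite (_ : v == w = all (fun j => v 0 j == w 0 j) (enum 'I_m)).
  by apply: (runs_allT (leq_enum_ord m)) => j _; exact: runs_ret.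
apply/eqP/allP => [-> //|vw]; apply/rowP => j; apply/eqP/vw.
by rewrite mem_enum.
Qed.

End Vectors.

(** * Prefix trees *)

Section PrefixTree.
Context {R : realFieldType}.
Implicit Types (v x : R) (key s caps pi y : seq R) (u w : @trie R) (ch : seq (R * @trie R)).
Implicit Types (P : seq R -> Prop) (L V k : nat).

(** Sets of keys are predicates because the one of the child labelled [v] is then
    obtained by composing with [cons v]. *)
Fixpoint represents L P u : Prop :=
  if L is L'.+1 then
    let: Node _ ch := u in
    [/\ sorted <%R (unzip1 ch),
        forall v, v \in unzip1 ch <-> exists s, P (v :: s) &
        List.Forall (fun c => represents L' (fun s => P (c.1 :: s)) c.2) ch]
  else True.

(** The measure to which all costs on trees are charged. *)
Fixpoint nodes L u : nat :=
  let: Node _ ch := u in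
  (if L is L'.+1 then sumn [seq nodes L' c.2 | c <- ch] else 0%N).+1.

Lemma represents_iff L P P' u :
  (forall s, P s <-> P' s) -> represents L P u -> represents L P' u.
Proof. by move=> PP'; rewrite (_ : P = P')//; apply/funext => s; apply/propext. Qed.

Lemma represents_empty L : represents L (fun=> False) empty_trie.
Proof. by case: L => //= L; split => // v; split => // -[]. Qed.

Lemma nodes_empty L : nodes L empty_trie = 1%N. Proof. by case: L. Qed.

Lemma nodes_gt0 L u : (0 < nodes L u)%N. Proof. by case: L u => [|L] []. Qed.

(** The inner recursion of [insertT], with the insertion into a child abstracted, so
    that it can be analysed on its own. *)
Definition insert_childT (ins : @trie R -> timed (@trie R)) v :=
  fix insert_childT ch : timed (seq (R * @trie R)) :=
    tick (match ch with
      | [::] =>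
          let* w := ins empty_trie in
          ret [:: (v, w)]
      | c :: cs =>
          let* same := eqT v c.1 in
          if same then
            let* w := ins c.2 in
            ret ((v, w) :: cs)
          else
            let* before := ltT v c.1 in
            if before then
              let* w := ins empty_trie in
              ret ((v, w) :: ch)
            else
              let* cs' := insert_childT cs in
              ret (c :: cs')
      end).

Lemma insertT_cons r v key st ch :
  insertT r (v :: key) (Node st ch) =
  tick (let* ch' := insert_childT (insertT r key) v ch in ret (Node (r :: st) ch')).
Proof. by []. Qed.

(** A single child changes: either the one labelled [v], or an empty tree that is
    placed at its position in the order. *)
Lemma insert_childP ins v ch : sorted <%R (unzip1 ch) ->
  let ch' := (insert_childT ins v ch).1 in
  sorted <%R (unzip1 ch') /\
  exists l r w, [/\ ch' = l ++ (v, (ins w).1) :: r,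
    ch = l ++ (v, w) :: r \/ [/\ ch = l ++ r, w = empty_trie & v \notin unzip1 ch] &
    ((insert_childT ins v ch).2 <= 3 * (size ch).+1 + (ins w).2)%N].
Proof.
elim: ch => [_|[v' u] ch IH].
  split=> //; exists [::], [::], empty_trie; split=> //; first by right.
  by rewrite /=; lia.
rewrite [sorted _ _]/= path_sortedE; last exact: lt_trans.
move=> /andP[v'ch sch] ; rewrite /insert_childT /=.
have [->|vv'] /= := eqVneq v v'.
  split; first by rewrite path_sortedE ?v'ch//; exact: lt_trans.
  by exists [::], ch, u; split=> //; [left|rewrite /=; lia].
have [ltvv'|lev'v] /= := ltP v v'.
  split; first by rewrite ltvv' path_sortedE ?v'ch//; exact: lt_trans.
  exists [::], ((v', u) :: ch), empty_trie; split=> //=; last by lia.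
  right; split=> //; rewrite in_cons negb_or vv'/=; apply/negP => /(allP v'ch).
  by rewrite ltNge (ltW ltvv').
have [] := IH sch; rewrite -/(insert_childT ins v) => sch' [l [r [w [E E' le]]]].
have ltv'v : v' < v by rewrite lt_neqAle eq_sym vv'.
split.
  rewrite path_sortedE ?sch' ?andbT; last exact: lt_trans.
  rewrite E /unzip1 map_cat all_cat /= ltv'v /=.
  by move: v'ch; case: E' => [->|[-> _ _]]; rewrite /unzip1 map_cat all_cat //= ltv'v.
exists ((v', u) :: l), r, w; split=> /=; first by rewrite E.
  case: E' => [->|[-> -> vch]]; [by left|right; split=> //].
  by rewrite in_cons negb_or vv'.
by lia.
Qed.

(** At most one node is created per coordinate of the key.  Scanning the children
    costs three steps for each, and a tree has fewer children than nodes. *)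
Lemma insertP r key L u P : size key = L -> represents L P u ->
  let w := insertT r key u in
  [/\ represents L (fun s => s = key \/ P s) w.1, (nodes L w.1 <= nodes L u + L)%N &
      forall V, (nodes L u <= V)%N -> (w.2 <= loop L (3 * V))%N].
Proof.
elim: L key u P => [|L IH] [|v key]// [st ch] P; first by [].
move=> [szk] [sch heads children]; rewrite insertT_cons /=.
have [sch' [l [t [w [E E' le]]]]] := insert_childP (insertT r key) v sch.
have [reprw nodesw timew] : [/\ represents L (fun s => s = key \/ P (v :: s)) (insertT r key w).1,
    (nodes L (insertT r key w).1 <= nodes L w + L)%N &
    forall V, (nodes L w <= V)%N -> ((insertT r key w).2 <= loop L (3 * V))%N].
  apply: IH => //; case: E' children => [->|[_ -> vch] _].
    by rewrite List.Forall_app List.Forall_cons_iff => -[_ []].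
  apply: represents_iff (represents_empty L) => s; split=> // Ps.
  by move/negP: vch; apply; apply/heads; exists s.
have uniq' : (v \notin unzip1 l) && (v \notin unzip1 t).
  have /lt_sorted_uniq := sch'; rewrite E /unzip1 map_cat cat_uniq /= negb_or.
  by case/and4P => _ /andP[-> _] ->.
split.
- split=> //.
    move=> v'; rewrite E /unzip1 map_cat mem_cat in_cons /=.
    have -> : (v' \in unzip1 l) || ((v' == v) || (v' \in unzip1 t)) =
        (v' == v) || (v' \in unzip1 ch).
      case: E' => [->|[-> _ _]]; rewrite /unzip1 map_cat mem_cat ?in_cons /=;
        by case: (v' == v); case: (v' \in _); case: (v' \in _).
    split=> [/predU1P[->|/heads[s Ps]]|[s [[-> _]|Ps]]].
    + by exists key; left.
    + by exists s; right.
    + by rewrite eqxx.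
    + by apply/orP; right; apply/heads; exists s.
  have other l' : v \notin unzip1 l' ->
      List.Forall (fun c => represents L (fun s => P (c.1 :: s)) c.2) l' ->
      List.Forall (fun c => represents L (fun s => c.1 :: s = v :: key \/ P (c.1 :: s)) c.2) l'.
    elim: l' => [|c l' IHl] // /norP[/eqP vc vl] /List.Forall_cons_iff[Pc Pl].
    apply/List.Forall_cons_iff; split; last exact: IHl.
    by apply: represents_iff Pc => s; split=> [|[[/esym]|]]; auto.
  have {uniq'} [vl vt] := andP uniq'.
  have [Pl Pt] : List.Forall (fun c => represents L (fun s => P (c.1 :: s)) c.2) l /\
      List.Forall (fun c => represents L (fun s => P (c.1 :: s)) c.2) t.
    case: E' children => [->|[-> _ _]]; rewrite List.Forall_app => -[Pl];
      by rewrite ?List.Forall_cons_iff => // -[].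
  rewrite E List.Forall_app List.Forall_cons_iff /=; split; first exact: other.
  split; last exact: other.
  apply: represents_iff reprw => s; split=> [[->|]|[[]|]]; auto.
- rewrite E map_cat sumn_cat /=.
  by case: E' => [->|[-> w0 _]]; rewrite map_cat sumn_cat /= ?w0 ?nodes_empty in nodesw *; lia.
- move=> V leV; rewrite loopS addn0.
  have szch : (size ch <= sumn [seq nodes L c.2 | c <- ch])%N.
    elim: (ch) => //= c ch' IHc; have := nodes_gt0 L c.2; lia.
  have /timew : (nodes L w <= V)%N.
    case: E' leV => [->|[_ -> _]]; last by rewrite nodes_empty; lia.
    by rewrite map_cat sumn_cat /=; lia.
  by lia.
Qed.

Lemma prefix_treeP (T : eqType) (h : T -> @round R) (s : seq T) L :
  (forall t : T, t \in s -> size (answer (h t)) = L) ->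
  let c := prefix_treeT [seq h t | t <- s] in
  [/\ represents L (fun key => exists2 t : T, t \in s & key = answer (h t)) c.1,
      (nodes L c.1 <= (size s * L).+1)%N &
      (c.2 <= loop (size s) (loop L (3 * (size s * L).+1)))%N].
Proof.
elim: s => [|x s IH] szL; rewrite /prefix_treeT /=.
  split; rewrite ?nodes_empty//.
  by apply: represents_iff (represents_empty L) => key; split=> // -[].
have [|repr nod time] := IH; first by move=> y ys; apply: szL; rewrite in_cons ys orbT.
have [|repr' nod' time'] := insertP (h x) (key := answer (h x)) _ repr.
  by apply: szL; rewrite mem_head.
split.
- apply: represents_iff repr' => key; split=> [[->|[y ys ->]]|[y]].
  + by exists x => //; rewrite mem_head.
  + by exists y => //; rewrite in_cons ys orbT.
  + by rewrite in_cons => /predU1P[->|ys] ->; [left|right; exists y].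
- by apply: (leq_trans nod'); rewrite mulSn; lia.
- rewrite loopS ltnS [leqRHS]addnC; apply: leq_add.
    by apply: (leq_trans time); rewrite leq_loop// leq_loop// leq_mul// mulSn; lia.
  by apply: time'; apply: (leq_trans nod); rewrite mulSn; lia.
Qed.
End PrefixTree.

(** * Cells *)

Section Cells.
Context {R : realFieldType}.
Implicit Types (v x c : R) (key s caps pi rho y vs : seq R) (u w : @trie R).
Implicit Types (ch : seq (R * @trie R)).
Implicit Types (P : seq R -> Prop) (I : interval R) (lo hi : itv_bound R) (L V k : nat).

Lemma itv_pointP (b b' : bool) (l h : R) : (BSide b l < BSide b' h)%O ->
  (itv_pointT (Interval (BSide b l) (BSide b' h))).1 \in
    Interval (BSide b l) (BSide b' h).
Proof.
case: b b' => -[] /=; rewrite in_itv /= bnd_simp ?lexx ?andbT /= => lh //.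
by apply/andP; split; [rewrite ltr_pdivlMr|rewrite ltr_pdivrMr]; lra.
Qed.

(** An interval starts after the last value passed and ends before the next one, so
    the order of the values keeps all of them out of it. *)
Lemma gaps_sound (b : bool) (l : R) vs c I : sorted <%R vs ->
  all (fun v => (BSide b l <= BLeft v)%O && (v <= c)) vs ->
  I \in (gapsT (BSide b l) vs c).1 -> (itv_pointT I).1 \in I /\
  forall x, x \in I -> [/\ (BSide b l <= BLeft x)%O, x <= c & x \notin vs].
Proof.
elim: vs b l => [|v vs IH] b l /=.
  move=> _ _; case: ifP => // lc; rewrite inE => /eqP ->; split.
    exact: itv_pointP.
  by move=> x; rewrite itv_boundlr => /andP[-> xc]; split.
rewrite path_sortedE; last exact: lt_trans.
move=> /andP[vvs svs] /andP[/andP[lv vc] vsc] I_in.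
have {I_in} : (BSide b l < BLeft v)%O && (I == Interval (BSide b l) (BLeft v)) ||
    (I \in (gapsT (BRight v) vs c).1).
  by move: I_in; case: ifP => //= _; rewrite inE.
case/orP => [/andP[lv' /eqP ->]|I_in].
  split; first exact: itv_pointP.
  move=> x; rewrite itv_boundlr => /andP[lx]; rewrite bnd_simp => xv.
  split=> //; first exact: le_trans (ltW xv) vc.
  rewrite in_cons lt_eqF//=; apply/negP => /(allP vvs)/(lt_trans xv).
  by rewrite ltxx.
have [//||pI boundsI] := IH false v _ _ I_in.
  apply/allP => z zvs; rewrite bnd_simp (allP vvs)//.
  by have /andP[] := allP vsc z zvs.
split=> // x /boundsI[vx xc xvs]; split=> //.
  by apply: le_trans vx; apply: (le_trans lv); rewrite bnd_simp.
by rewrite in_cons negb_or xvs andbT gt_eqF.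
Qed.

Lemma gaps_cover lo vs c x : (lo <= BLeft x)%O -> x <= c -> x \notin vs ->
  exists2 I, I \in (gapsT lo vs c).1 & x \in I.
Proof.
elim: vs lo => [|v vs IH] lo lox xc /=.
  move=> _; exists (Interval lo (BRight c)).
    by rewrite (le_lt_trans lox) ?bnd_simp//= mem_head.
  by rewrite itv_boundlr lox bnd_simp.
rewrite in_cons negb_or => /andP[xv xvs].
have [ltxv|ltvx|eqxv] := ltgtP x v; last by rewrite eqxv eqxx in xv.
  exists (Interval lo (BLeft v)); last by rewrite itv_boundlr lox bnd_simp.
  by rewrite (le_lt_trans lox) ?bnd_simp//= mem_head.
have [|I I_in xI] := IH (BRight v) _ xc xvs; first by rewrite bnd_simp.
by exists I => //; case: ifP => //; rewrite in_cons I_in orbT.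
Qed.

Lemma gaps_cost lo vs c :
  (size (gapsT lo vs c).1 <= (size vs).+1)%N /\ (gapsT lo vs c).2 = (2 * (size vs).+1)%N.
Proof.
elim: vs lo => [|v vs IH] lo /=; first by case: ifP.
by have [size_le time] := IH (BRight v); split; [case: ifP => _ /=; lia|lia].
Qed.

Lemma cells_cons c caps pi st ch (r := cells_fromT (c :: caps) pi (Node st ch))
    (g := gapsT (BLeft 0) (unzip1 ch) c)
    (below := fun e : R * @trie R => cells_fromT caps (rcons pi e.1) e.2) :
  r.1 = [seq (pi, J) | J <- g.1] ++ flatten [seq (below e).1 | e <- ch] /\
  r.2 = ((size ch).+1 + g.2 + (size g.1).+1 +
    (sumn [seq (size pi + (below e).2 + size (below e).1).+3 | e <- ch]).+1 +
    (size g.1).+1).+1.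
Proof.
have belowE : (fun e : R * @trie R =>
    let* pi' := rconsT pi e.1 in cells_fromT caps pi' e.2) =
    (fun e => ((below e).1, (size pi).+1 + (below e).2)%N).
  by apply/funext => e; rewrite /rconsT /bind catT_val catT_cost cats1.
rewrite /r /= belowE !mapT_val /= -/(unzip1 ch) -/g.
rewrite catT_val catT_cost flatmapT_val flatmapT_cost size_map /=.
split=> //; have -> : [seq ((size pi).+1 + (below e).2 + size (below e).1).+2 | e <- ch] =
    [seq (size pi + (below e).2 + size (below e).1).+3 | e <- ch].
  by apply: eq_map => e; rewrite !addSn.
by lia.
Qed.

(** The cost is charged to the nodes.  As a node has fewer than [V] children, it
    spends at most [5 * V + 9] steps on them and on the gaps; its parent spends at
    most [k + 3 + 2 * V] steps to extend the prefix and to concatenate the cells of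
    the node to those of its siblings.  The latter term is added on the left of the
    bound because the root has no parent.  A node has at most one gap more than it
    has children, whence the bound on the number of cells. *)
Lemma cells_cost V k caps pi u (r := cells_fromT caps pi u) :
  (nodes (size caps) u <= V)%N -> (size pi + size caps <= k)%N ->
  (size r.1 < 2 * nodes (size caps) u)%N /\
  (r.2 + (k + 3 + 2 * V) <= nodes (size caps) u * (7 * V + k + 12))%N.
Proof.
rewrite {}/r; elim: caps pi u => [|c caps IH] pi [st ch] leV lek.
  by split=> //=; lia.
have [-> ->] := cells_cons c caps pi st ch.
have [] := gaps_cost (BLeft 0) (unzip1 ch) c; rewrite size_map.
set g := gapsT _ _ _ => size_g ->.
pose N := sumn [seq nodes (size caps) e.2 | e <- ch].
have nodesE : nodes (size (c :: caps)) (Node st ch) = N.+1 by [].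
rewrite nodesE in leV *; rewrite size_cat size_map size_flatten /shape -map_comp /=.
have : (sumn [seq size (cells_fromT caps (rcons pi e.1) e.2).1 | e <- ch] + size ch <= 2 * N)%N /\
  (sumn [seq (size pi + (cells_fromT caps (rcons pi e.1) e.2).2 +
     size (cells_fromT caps (rcons pi e.1) e.2).1).+3 | e <- ch] <=
   N * (7 * V + k + 12))%N /\ (size ch <= N)%N.
  have NV : (N <= V)%N by lia.
  rewrite /= in lek.
  rewrite {size_g g nodesE leV}/N in NV *; elim: ch NV => //= e ch IHch NV.
  have [||size_e time_e] := IH (rcons pi e.1) e.2; first by lia.
    by rewrite size_rcons; lia.
  have [|size_ch [time_ch len_ch]] := IHch; first by lia.
  have := nodes_gt0 (size caps) e.2; rewrite mulnDl; lia.
move=> [size_ch [time_ch len_ch]]; rewrite mulSn.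
rewrite -[[seq (size \o _) i | i <- ch]]/
  [seq size (cells_fromT caps (rcons pi e.1) e.2).1 | e <- ch].
by split; lia.
Qed.

Lemma mem_flatten_In (A : Type) (B : eqType) (f : A -> seq B) (l : seq A) z :
  z \in flatten [seq f t | t <- l] <-> exists2 t, List.In t l & z \in f t.
Proof.
elim: l => [|t l IH] /=; first by split=> // -[].
rewrite mem_cat; split=> [/orP[zt|/IH[t' ? ?]]|[t' [<- ->//|t'l zt']]].
- by exists t => //; left.
- by exists t' => //; right.
- by apply/orP; right; apply/IH; exists t'.
Qed.

Lemma mem_map_In (A : Type) (B : eqType) (f : A -> B) (l : seq A) z :
  z \in [seq f t | t <- l] <-> exists2 t, List.In t l & z = f t.
Proof.
elim: l => [|t l IH] /=; first by split=> // -[].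
rewrite in_cons; split=> [/predU1P[->|/IH[t' ? ->]]|[t' [<- ->//|t'l zE]]].
- by exists t => //; left.
- by exists t' => //; right.
- by rewrite eqxx.
- by apply/orP; right; apply/IH; exists t'.
Qed.

Definition in_box caps y := all2 (fun c x => 0 <= x <= c) caps y.

(** The last conclusion is what makes a cell useful: a key extending its prefix has
    its next coordinate among the children of the node, hence outside [I]. *)
Lemma cells_sound caps pi rho u I P : represents (size caps) P u ->
  (forall s, P s -> in_box caps s) ->
  (rho, I) \in (cells_fromT caps pi u).1 ->
  exists pi', [/\ rho = pi ++ pi' /\ (size pi' < size caps)%N,
    pi' = [::] \/ exists s, P (pi' ++ s),
    (itv_pointT I).1 \in I, forall x, x \in I -> 0 <= x <= nth 0 caps (size pi') &
    forall v s, P (pi' ++ v :: s) -> v \notin I].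
Proof.
elim: caps pi u P => [|c caps IH] pi [st ch] P //.
move=> [sch heads children] box; rewrite (cells_cons c caps pi st ch).1.
rewrite mem_cat => /orP[/mapP[J J_in [-> ->]]|].
  have [|pJ boundsJ] := gaps_sound sch _ J_in.
    apply/allP => v /heads[s /box] /= /andP[/andP[v0 vc] _].
    by rewrite bnd_simp v0.
  exists [::]; split=> //; first by rewrite cats0.
  - by left.
  - by move=> x /boundsJ[]; rewrite bnd_simp => -> ->.
  - move=> v s Pvs; apply/negP => /boundsJ[_ _ /negP]; apply.
    by apply/heads; exists s.
move=> /mem_flatten_In[e e_in rho_in].
have [] := IH _ _ (fun s => P (e.1 :: s)) _ _ rho_in.
- exact: (List.Forall_forall _ _).1 children e e_in.
- by move=> s /box /= /andP[].
move=> pi' [[-> szpi'] prefix pI boundsI freeI].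
exists (e.1 :: pi'); split=> //.
- by rewrite cat_rcons.
- right; case: prefix => [->|[s Ps]]; last by exists s.
  by apply/heads/mem_map_In; exists e.
Qed.

(** Follow [y] down the tree until one of its coordinates is not the label of a
    child, which happens as [y] is not a key.  The third hypothesis excludes the
    tree of depth zero without keys, which has no cell at all. *)
Lemma cells_cover caps pi y u P : represents (size caps) P u ->
  (forall s, P s -> in_box caps s) -> (0 < size caps)%N \/ (exists s, P s) ->
  in_box caps y -> ~ P y ->
  exists pi' J, [/\ (pi ++ pi', J) \in (cells_fromT caps pi u).1,
    take (size pi') y = pi' & nth 0 y (size pi') \in J].
Proof.
elim: caps pi y u P => [|c caps IH] pi [|x y] [st ch] P //.
  move=> _ box [//|[s Ps]] _ []; move: (box s Ps); rewrite /in_box.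
  by case: s Ps.
move=> [sch heads children] box _ /andP[/andP[x0 xc] boxy] notP.
rewrite (cells_cons c caps pi st ch).1.
have [|xch] := boolP (x \in unzip1 ch); last first.
  have [|J J_in xJ] := gaps_cover (lo := BLeft 0) _ xc xch; first by rewrite bnd_simp.
  by exists [::], J; rewrite cats0 mem_cat map_f.
move=> /mem_map_In[e e_in xe]; rewrite {}xe in notP *.
have [|||pi' [J [J_in take_y y_in]]] :=
    IH (rcons pi e.1) y e.2 (fun s => P (e.1 :: s)) _ _ _ boxy notP.
- exact: (List.Forall_forall _ _).1 children e e_in.
- by move=> s /box /andP[].
- by right; apply/heads/mem_map_In; exists e.
exists (e.1 :: pi'), J; split=> //=; last by rewrite take_y.
rewrite mem_cat; apply/orP; right; apply/mem_flatten_In; exists e => //.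
by rewrite -cat_rcons.
Qed.

End Cells.

(** * Orientation patterns *)

Section Tau.
Context {R : realFieldType}.
Implicit Types (x y v s : R) (p qs ys zs : seq R) (J : interval R).

Lemma itv_same_side J x y v : x \in J -> y \in J -> v \notin J ->
  [/\ x != v, y != v & Num.sg (x - v) = Num.sg (y - v)].
Proof.
have mid z1 z2 : z1 \in J -> z2 \in J -> z1 <= v <= z2 -> v \in J.
  case: J => l h; rewrite !itv_boundlr => /andP[lz1 _] /andP[_ z2h] /andP[z1v vz2].
  by rewrite (le_trans lz1) ?bnd_simp//= (le_trans _ z2h) ?bnd_simp.
move=> xJ yJ vJ.
have [xv yv] : x != v /\ y != v by split; apply: contraNneq vJ => <-.
split=> //; have [ltxv|ltvx|eqxv] := ltgtP x v; last by rewrite eqxv eqxx in xv.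
  have [ltyv|ltvy|eqyv] := ltgtP y v; last by rewrite eqyv eqxx in yv.
    by rewrite !ltr0_sg ?subr_lt0.
  by rewrite (mid x y) ?ltW in vJ.
have [ltyv|ltvy|eqyv] := ltgtP y v; last by rewrite eqyv eqxx in yv.
  by rewrite (mid y x) ?ltW in vJ.
by rewrite !gtr0_sg ?subr_gt0.
Qed.

(** If the answer [qs] leaves the common prefix of [ys] and [zs], then the first
    difference is within this prefix.  Otherwise it is at the coordinate [k], where
    [ys] and [zs] are on the same side of [qs]. *)
Lemma tau_round_cell J k p qs ys zs :
  size qs = size p -> size ys = size p -> size zs = size p -> (k < size p)%N ->
  take k ys = take k zs -> nth 0 ys k \in J -> nth 0 zs k \in J ->
  (take k qs = take k ys -> nth 0 qs k \notin J) ->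
  (tau_roundT p qs ys).1 = (tau_roundT p qs zs).1.
Proof.
elim: k p qs ys zs => [|k IH] [|a p] [|v qs] [|y ys] [|z zs] //= [szq] [szy] [szz].
  move=> _ _ yJ zJ /(_ erefl) vJ; have [yv zv yz] := itv_same_side yJ zJ vJ.
  by rewrite (negPf yv) (negPf zv) /= !sgrM yz.
move=> ltk [<- take_yz] yJ zJ free.
have [yv|] := eqVneq y v => //=; apply: IH => // take_q.
by apply: free; rewrite take_q yv.
Qed.

(** All nonzero products have the sign [s], in particular the first one. *)
Lemma tau_round_oriented s p qs ys : signed s ->
  size qs = size p -> size ys = size p -> ys != qs ->
  (forall j, (j < size p)%N ->
    nth 0 p j != 0 /\ 0 <= s * nth 0 p j * (nth 0 ys j - nth 0 qs j)) ->
  (tau_roundT p qs ys).1 = s.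
Proof.
move=> ss; elim: p qs ys => [|a p IH] [|v qs] [|y ys] //= [szq] [szy].
move=> neq_yq orient; have [yv|yv] := eqVneq y v => /=.
  apply: IH => // [|j ltj]; last exact: (orient j.+1).
  by apply: contraNneq neq_yq => ->; rewrite yv.
have [a0] := orient 0%N isT; rewrite /= -mulrA => orient0.
have d0 : Num.sg (a * (y - v)) != 0 by rewrite sgr_eq0 mulf_neq0// subr_eq0.
case: ss orient0 => ->; rewrite ?mul1r ?mulN1r ?oppr_ge0 => ge0.
  by rewrite gtr0_sg// lt_def ge0 andbT -sgr_eq0.
by rewrite ltr0_sg// lt_def ge0 andbT eq_sym -sgr_eq0.
Qed.

Lemma tau_round_signed p qs ys :
  size qs = size p -> size ys = size p -> ys != qs ->
  (forall j, (j < size p)%N -> nth 0 p j != 0) -> signed (tau_roundT p qs ys).1.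
Proof.
elim: p qs ys => [|a p IH] [|v qs] [|y ys] //= [szq] [szy] neq_yq a0.
have [yv|yv] := eqVneq y v => /=.
  apply: IH => // [|j ltj]; last exact: (a0 j.+1).
  by apply: contraNneq neq_yq => ->; rewrite yv.
have : a * (y - v) != 0 by rewrite mulf_neq0 ?subr_eq0// (a0 0%N).
by case: sgrP => // _ _; [left|right].
Qed.

Lemma runs_tau_roundT p qs ys k : (size p <= k)%N ->
  runs (tau_roundT p qs ys) (tau_roundT p qs ys).1 (loop k 4).
Proof.
move=> szp; split=> //; apply: leq_trans (leq_loop szp (leqnn 4)).
elim: p qs ys {szp} => [|a p IH] [|v qs] [|y ys] //=; rewrite loopS.
by case: (y == v) => /=; first (have := IH qs ys); lia.
Qed.

End Tau.

(** * Boxes and their points outside the answers *)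

Lemma size_coords (R : realType) m (x : 'rV[R]_m) : size (coords x) = m.
Proof. by rewrite size_map size_enum_ord. Qed.

Lemma nth_coords (R : realType) m (x : 'rV[R]_m) (j : 'I_m) : nth 0 (coords x) j = x 0 j.
Proof. by rewrite (nth_map j) ?size_enum_ord// nth_ord_enum. Qed.

Lemma coords_row (R : realType) m (f : 'I_m -> R) :
  [seq f j | j <- enum 'I_m] = coords (\row_j f j).
Proof. by apply: eq_map => j; rewrite mxE. Qed.

(** The running time bounds are nested like the programs, so that the rules
    of the judgement produce them without arithmetic. *)
Definition eqv_time m := (loop m 1 + loop m 0)%N.
Definition is_answer_time m n := loop n (eqv_time m).
Definition box_time m n := (loop m 0 + (loop n 0 + loop n (loop m 0 + loop m 3)))%N.
Definition non_answer_time m n :=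
  (loop m 1 + (loop m 1 + (loop m 0 + is_answer_time m n)))%N.
Definition search_time m n k := loop k.+1 (loop m 3 + is_answer_time m n + 1).

Lemma runs_bind_ret (A B : Type) (c : timed A) v b (f : A -> B) :
  runs c v b -> runs (let* x := c in ret (f x)) (f v) b.
Proof. by move=> cv; rewrite -[b]addn0; apply: (runs_bind cv); exact: runs_ret. Qed.

Section Boxes.
Context (R : realType) (m n : nat) (D : survey R m n).
Implicit Types (y : 'rV[R]_m) (sigma : 'rV[R]_n) (sd : 'I_m -> R * R).

Definition round_of i := Round (coords (a D i)) (coords (q D i)).

Definition is_answer y := y \in [seq q D i | i <- enum 'I_n].

Lemma is_answerP y : reflect (answers D y) (is_answer y).
Proof.
apply: (iffP mapP) => [[i _ ->]|[i _ <-]]; first by exists i.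
by exists i; rewrite ?mem_enum.
Qed.

Lemma runs_is_answerT y :
  runs (is_answerT (coords y) (rounds (encode D))) (is_answer y) (is_answer_time m n).
Proof.
rewrite (_ : is_answer y = has (fun i => y == q D i) (enum 'I_n)).
  by apply: (runs_hasT (leq_enum_ord n)) => i _; exact: runs_eqvT.
by rewrite /is_answer -has_pred1 has_map; apply: eq_has => i /=; rewrite eq_sym.
Qed.

Definition box_of sd := [seq sd j | j <- enum 'I_m].

Definition in_sides sd y := forall j, (sd j).1 <= y 0 j <= (sd j).2.

Definition tighten (s : R) i sd j : R * R :=
  if 0 < s * a D i 0 j then (Num.max (sd j).1 (q D i 0 j), (sd j).2)
  else ((sd j).1, Num.min (sd j).2 (q D i 0 j)).

Definition sides sigma : 'I_m -> R * R :=
  foldr (fun i => tighten (sigma 0 i) i) (fun j => (0, cap D 0 j)) (enum 'I_n).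

Lemma runs_boxT sigma :
  runs (boxT (encode D) (coords sigma)) (box_of (sides sigma)) (box_time m n).
Proof.
apply: runs_bind.
  by apply: (runs_mapT (leq_enum_ord m)) => j _; exact: runs_ret.
apply: runs_bind; first exact: (runs_zipT _ _ (leq_enum_ord n)).
apply: (runs_foldT box_of (leq_enum_ord n)) => i sd _ /=.
apply: runs_bind; first exact: (runs_zipT _ _ (leq_enum_ord m)).
apply: (runs_map2T (leq_enum_ord m)) => j _; rewrite /tighten.
apply: (runs_bind (b := 1)); first exact: runs_op.
apply: (runs_bind (b := 1)); first exact: runs_op.
by case: ifP => _; apply: (runs_bind_ret (b := 1)); exact: runs_op.
Qed.

(** As coefficients are nonzero, [oriented] bounds each coordinate from one side only,
    and every round tightens the corresponding end of each side. *)
Lemma sidesP sigma y : (forall i j, a D i 0 j != 0) -> (forall i, signed (sigma 0 i)) ->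
  in_sides (sides sigma) y <-> X D y /\ forall i, oriented D i (sigma 0 i) y.
Proof.
move=> a0 ss; rewrite /sides.
have s0 i := signed_neq0 (ss i).
have : in_sides (foldr (fun i => tighten (sigma 0 i) i) (fun j => (0, cap D 0 j)) (enum 'I_n)) y <->
    X D y /\ forall i, i \in enum 'I_n -> oriented D i (sigma 0 i) y.
  elim: (enum 'I_n) => [|i l IH] /=; first by split=> [|[]].
  have step sd : in_sides (tighten (sigma 0 i) i sd) y <->
      in_sides sd y /\ oriented D i (sigma 0 i) y.
    have stepj j : (tighten (sigma 0 i) i sd j).1 <= y 0 j <= (tighten (sigma 0 i) i sd j).2 =
        ((sd j).1 <= y 0 j <= (sd j).2) && (0 <= sigma 0 i * a D i 0 j * (y 0 j - q D i 0 j)).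
      rewrite /tighten; case: ltgtP => [sa|sa|/esym/eqP] /=.
      - by rewrite pmulr_rge0// subr_ge0 ge_max; do 3!case: (_ <= _).
      - by rewrite nmulr_rge0// subr_le0 le_min; do 3!case: (_ <= _).
      - by rewrite mulf_eq0 (negPf (a0 i j)) (negPf (s0 i)).
    split=> [tgt|[sdy oy] j]; last by rewrite stepj sdy oy.
    by split=> j; have := tgt j; rewrite stepj => /andP[].
  rewrite step IH; split=> [[[Xy ol] oi]|[Xy ol]].
    by split=> // i'; rewrite in_cons => /predU1P[->|/ol].
  by split; [split=> // i' i'l|]; apply: ol; rewrite in_cons ?i'l ?eqxx ?orbT.
by move=> ->; split=> -[Xy o]; split=> // i *; apply: o; rewrite ?mem_enum.
Qed.

Lemma orthant_boxE sigma y : (forall i, signed (sigma 0 i)) ->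
  orthant_box D sigma y <-> X D y /\ forall i, oriented D i (sigma 0 i) y.
Proof.
move=> ss; have orthE i : X D y ->
    (if 0 < sigma 0 i then orthant_pos D i else orthant_neg D i) y <->
    oriented D i (sigma 0 i) y.
  move=> Xy; rewrite /oriented; case: (ss i) => ->; rewrite ?ltr01 ?ltr0N1 //=.
    by split=> [[_ o] j|o]; [rewrite mul1r|split=> // j; rewrite -[a D i 0 j]mul1r].
  split=> [[_ o] j|o].
    by rewrite mulN1r mulNr oppr_ge0.
  by split=> // j; rewrite -oppr_ge0 -mulNr -mulN1r.
by split=> -[Xy o]; split=> // i; apply/(orthE i Xy); exact: o.
Qed.

(** The search for a peak tries these points for k = 1, 2, 3 and so on.  For [k = 1]
    it is the upper corner of the box, which is the only point of a one-point box. *)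
Definition candidate sd (k : R) : 'rV[R]_m :=
  \row_j ((sd j).1 + ((sd j).2 - (sd j).1) / k).

Lemma candidate_in sd k : 1 <= k -> (forall j, (sd j).1 <= (sd j).2) ->
  in_sides sd (candidate sd k).
Proof.
move=> k1 sdP j; have k0 : 0 < k by exact: lt_le_trans k1.
rewrite mxE lerDl divr_ge0 ?subr_ge0 ?(ltW k0)//= -lerBrDl.
by rewrite ler_pdivrMr// ler_peMr// subr_ge0.
Qed.

(** The first [n.+1] candidates are pairwise distinct, and there are only [n]
    answers. *)
Lemma thick_candidate sd j : (sd j).1 < (sd j).2 ->
  exists2 k, (k <= n)%N & ~~ is_answer (candidate sd k.+1%:R).
Proof.
move=> thick; apply: contrapT => none.
pose f (k : 'I_n.+1) := candidate sd k.+1%:R.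
have f_inj : injective f.
  move=> k k' /rowP/(_ j); rewrite !mxE => /addrI/(mulfI _)/invr_inj.
  rewrite subr_eq0 gt_eqF// => /(_ isT) /eqP; rewrite eqr_nat eqSS => /eqP.
  exact: val_inj.
have := uniq_leq_size (s1 := map f (enum 'I_n.+1)) (s2 := [seq q D i | i <- enum 'I_n]).
rewrite map_inj_uniq// enum_uniq (size_map f) (size_map (q D)) !size_enum_ord ltnn.
move=> /(_ isT) impossible.
suff : false by [].
apply: impossible => _ /mapP[k _ ->]; apply: contrapT => notans.
by apply: none; exists k; [rewrite -ltnS|exact/negP].
Qed.

Lemma non_answer_candidate sd :
  (exists2 y, in_sides sd y & ~ answers D y) <->
  (forall j, (sd j).1 <= (sd j).2) /\
  exists2 k, (k <= n)%N & ~~ is_answer (candidate sd k.+1%:R).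
Proof.
split=> [[y sdy notans]|[sdP [k kn notans]]].
  have sdP j : (sd j).1 <= (sd j).2 by have /andP[] := sdy j; exact: le_trans.
  split=> //; have [[j thick]|thin] := pselect (exists j, (sd j).1 < (sd j).2).
    exact: thick_candidate thick.
  exists 0%N => //; apply/is_answerP; rewrite (_ : candidate _ _ = y)//.
  apply/rowP => j; rewrite mxE divr1 addrC subrK; have /andP[y1 y2] := sdy j.
  apply/le_anti; rewrite y2 andbT leNgt; apply/negP => lt2.
  by apply: thin; exists j; exact: le_lt_trans lt2.
exists (candidate sd k.+1%:R); last exact/is_answerP.
by apply: candidate_in; rewrite ?ler1n.
Qed.

Lemma runs_has_non_answerT sd : exists2 b : bool,
  runs (has_non_answerT (encode D) (box_of sd)) b (non_answer_time m n) &
  b <-> exists2 y, in_sides sd y & ~ answers D y.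
Proof.
have nonempty := runs_allT (p := fun side => leT side.1 side.2) (h := sd)
  (leq_enum_ord m) (fun j _ => runs_op ((sd j).1 <= (sd j).2)).
have thick := runs_hasT (p := fun side => ltT side.1 side.2) (h := sd)
  (leq_enum_ord m) (fun j _ => runs_op ((sd j).1 < (sd j).2)).
have [/allP sdP|sdN] := boolP (all (fun j => (sd j).1 <= (sd j).2) (enum 'I_m)); last first.
  exists false.
    apply: runs_bind nonempty _; rewrite sdN.
    exact: runs_weak (leq0n _) (runs_ret _).
  split=> // -[y sdy _]; case/allPn: sdN => j _ /negP[].
  by have /andP[] := sdy j; exact: le_trans.
have {}sdP j : (sd j).1 <= (sd j).2 by apply: sdP; exact: mem_enum.
have allT' : all (fun j => (sd j).1 <= (sd j).2) (enum 'I_m) by apply/allP => j _.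
have [/hasP[j _ ltj]|notthick] := boolP (has (fun j => (sd j).1 < (sd j).2) (enum 'I_m)).
  exists true.
    apply: runs_bind nonempty _; rewrite allT' /=; apply: runs_bind thick _.
    rewrite (_ : has _ _ = true); last by apply/hasP; exists j; rewrite ?mem_enum.
    exact: runs_weak (leq0n _) (runs_ret _).
  by split=> // _; apply/non_answer_candidate; split=> //; exact: thick_candidate ltj.
exists (~~ is_answer (\row_j (sd j).1)).
  apply: runs_bind nonempty _; rewrite allT' /=; apply: runs_bind thick _.
  rewrite (negPf notthick); apply: runs_bind.
    by apply: (runs_mapT (leq_enum_ord m)) => j _; exact: runs_ret.
  by rewrite coords_row; apply: runs_bind_ret; exact: runs_is_answerT.
split=> [/is_answerP notans|[y sdy notans]].
  by exists (\row_j (sd j).1) => // j; rewrite mxE lexx sdP.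
apply/is_answerP; rewrite (_ : \row_j _ = y)//; apply/rowP => j; rewrite mxE.
have /andP[y1 y2] := sdy j; apply/le_anti; rewrite y1 (le_trans y2)// leNgt.
by apply: contra notthick => ltj; apply/hasP; exists j; rewrite ?mem_enum.
Qed.

Lemma runs_candidate sd (k : R) :
  runs (mapT (fun side => let* w := subT side.2 side.1 in
                          let* d := divT w k in addT side.1 d) (box_of sd))
    (coords (candidate sd k)) (loop m 3).
Proof.
rewrite -coords_row; apply: (runs_mapT (leq_enum_ord m)) => j _.
apply: (runs_bind (b := 1)); first exact: runs_op.
by apply: (runs_bind (b := 1)); exact: runs_op.
Qed.

Lemma searchP sd (fuel : seq (@round R)) k :
  (exists2 l, (k <= l <= k + size fuel)%N & ~~ is_answer (candidate sd l.+1%:R)) ->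
  exists2 l, ~~ is_answer (candidate sd l.+1%:R) &
    runs (searchT (encode D) (box_of sd) k.+1%:R fuel) (coords (candidate sd l.+1%:R))
      (search_time m n (size fuel)).
Proof.
elim: fuel k => [|r fuel IH] k [l /andP[kl lk] notans];
    have [ans|notans'] := boolP (is_answer (candidate sd k.+1%:R)).
- have lkE : l = k by move: lk; rewrite /= addn0; lia.
  by rewrite lkE ans in notans.
- exists k => //; rewrite /search_time loopS; apply: runs_tick; rewrite -2!addnA.
  apply: (runs_bind (runs_candidate _ _)); apply: (runs_bind (runs_is_answerT _)).
  by rewrite notans'; exact: runs_weak (leq0n _) (runs_ret _).
- have [|l' notans' search] := IH k.+1.
    exists l => //; rewrite addSnnS lk andbT ltn_neqAle kl andbT.
    by apply: contraNneq notans => <-.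
  exists l' => //; rewrite /search_time loopS; apply: runs_tick; rewrite -2!addnA.
  apply: (runs_bind (runs_candidate _ _)); apply: (runs_bind (runs_is_answerT _)).
  rewrite ans; apply: (runs_bind (v := k.+2%:R)) search.
  by rewrite -(natr1 k.+1); exact: runs_op.
- exists k => //; rewrite /search_time loopS; apply: runs_tick; rewrite -2!addnA.
  apply: (runs_bind (runs_candidate _ _)); apply: (runs_bind (runs_is_answerT _)).
  by rewrite notans'; exact: runs_weak (leq0n _) (runs_ret _).
Qed.

End Boxes.

(** * Transitive closure and GARP *)

Definition gain_time m := (loop m 1 + (loop m 1 + loop m 1))%N.
Definition closure_step_time n :=
  (loop n 0 + loop n (loop n 0 + loop n 0))%N.
Definition closure_time n := loop n (closure_step_time n).
Definition garp_time m n :=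
  (loop n (loop n (gain_time m + 1)) + (loop n (loop n (gain_time m + 1)) +
   (closure_time n + (loop n (loop n 0 + loop n 0) + loop n 0))))%N.

Section Warshall.
Context (l n : nat) (ln : (l <= n)%N).
Implicit Types (w : rel 'I_l).

Let enum_le : (size (enum 'I_l) <= n)%N.
Proof. by rewrite size_enum_ord. Qed.

Definition table (T : Type) (w : 'I_l -> 'I_l -> T) : seq (seq T) :=
  [seq [seq w i j | j <- enum 'I_l] | i <- enum 'I_l].

Lemma runs_table (A T : Type) (f : A -> A -> timed T) (h : 'I_l -> A) (w : 'I_l -> 'I_l -> T) b :
  (forall i j, runs (f (h i) (h j)) (w i j) b) ->
  runs (mapT (fun s => mapT (f s) [seq h i | i <- enum 'I_l]) [seq h i | i <- enum 'I_l])
    (table w) (loop n (loop n b)).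
Proof. by move=> fw; do 2!apply: (runs_mapT enum_le) => ? _. Qed.

Lemma nth_table (T : Type) (x0 : T) (w : 'I_l -> 'I_l -> T) (k : 'I_l) :
  nth [::] (table w) k = [seq w k j | j <- enum 'I_l].
Proof. by rewrite (nth_map k) ?size_enum_ord// nth_ord_enum. Qed.

Definition warshall_step (k : 'I_l) w : rel 'I_l :=
  fun i j => w i j || (w i k && w k j).

Lemma runs_closure_stepT (k : 'I_l) w :
  runs (closure_stepT k (table w)) (table (warshall_step k w)) (closure_step_time n).
Proof.
apply: runs_bind.
  apply: runs_weak (runs_nthT _ _ _).
  by rewrite size_map leq_loop.
rewrite (nth_table false); apply: (runs_mapT enum_le) => i _.
have := runs_nthT false [seq w i j | j <- enum 'I_l] k.
rewrite (nth_map k) ?size_enum_ord// nth_ord_enum size_map => via.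
apply: runs_bind; first by apply: runs_weak via; rewrite leq_loop.
rewrite /warshall_step; case: (w i k) => /=.
  by apply: (runs_map2T enum_le) => j _; exact: runs_ret.
rewrite (_ : [seq _ | j <- _] = [seq w i j | j <- enum 'I_l]).
  exact: runs_weak (leq0n _) (runs_ret _).
by apply: eq_map => j; rewrite orbF.
Qed.

(** The invariant of the passes.  Once all indices are admitted as intermediate
    points, the relation is transitive, hence it is the closure of [e]. *)
Definition closed_below (e : rel 'I_l) (k : nat) w :=
  [/\ subrel e w, subrel w (connect e) &
      forall h : 'I_l, (h < k)%N -> forall i j, w i h -> w h j -> w i j].

Lemma warshall_step_closed e (k : 'I_l) w :
  closed_below e k w -> closed_below e k.+1 (warshall_step k w).
Proof.
move=> [ew we trans]; split.
- by move=> i j /ew wij; rewrite /warshall_step wij.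
- move=> i j /orP[/we//|/andP[/we ik /we kj]]; exact: connect_trans ik kj.
move=> h; rewrite ltnS leq_eqVlt => /predU1P[hk|hk] i j.
  rewrite /warshall_step (val_inj hk : h = k).
  by case: (w i k) => //=; case: (w i j); case: (w k k); case: (w k j).
have th := trans h hk; rewrite /warshall_step.
move=> /orP[ih|/andP[ik kh]] /orP[hj|/andP[hk' kj]]; apply/orP.
- by left; exact: th ih hj.
- by right; rewrite (th _ _ ih hk').
- by right; rewrite ik (th _ _ kh hj).
- by right; rewrite ik.
Qed.

Lemma runs_closureT (A : Type) e (fuel : seq A) (k : nat) w :
  (k + size fuel = l)%N -> closed_below e k w ->
  exists2 w', closed_below e l w' &
    runs (Defs.closureT fuel k (table w)) (table w') (loop (size fuel) (closure_step_time n)).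
Proof.
elim: fuel k w => [|x fuel IH] k w.
  by rewrite addn0 => kl cl; exists w => //; rewrite -[X in closed_below _ X]kl.
rewrite /= addnS -addSn => kl cl.
have ltkl : (k < l)%N by rewrite -kl leq_addr.
have [w' cl' run'] := IH k.+1 _ kl (@warshall_step_closed e (Ordinal ltkl) w cl).
exists w' => //; rewrite loopS; apply: runs_tick; apply: runs_bind run'.
exact: (runs_closure_stepT (Ordinal ltkl)).
Qed.

Lemma closed_connect e w : reflexive e -> closed_below e l w -> w =2 connect e.
Proof.
move=> e_refl [ew we trans] i j; apply/idP/idP; first exact: we.
move=> /connectP[p pth ->]; elim/last_ind: p pth => [_|p k IH]; first exact/ew/e_refl.
rewrite rcons_path last_rcons => /andP[pth ek].
by apply: (trans (last i p) _ _ _ (IH pth)); [exact: ltn_ord|exact: ew].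
Qed.

End Warshall.

Section TestGARP.
Context (R : realType) (m n l : nat) (ln : (l <= n)%N) (x p : 'I_l -> 'rV[R]_m).

Let enum_le : (size (enum 'I_l) <= n)%N.
Proof. by rewrite size_enum_ord. Qed.

Let datum t := (coords (x t), coords (p t)).

Lemma runs_gainT s t : runs (gainT (datum s) (datum t)) (dot (p s) (x s - x t)) (gain_time m).
Proof.
apply: (runs_bind (v := coords (x s - x t))); last exact: runs_dotT.
rewrite (_ : coords (x s - x t) = [seq x s 0 j - x t 0 j | j <- enum 'I_m]).
  by apply: (runs_map2T (leq_enum_ord m)) => j _; exact: runs_op.
by apply: eq_map => j; rewrite !mxE.
Qed.

(** The gain from [s] to itself is zero, so the weak relation is reflexive and its
    transitive closure, computed by the program, is [connect]. *)
Lemma runs_std_garp : exists2 b : bool,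
  runs (std_garp [seq datum t | t <- enum 'I_l]) b (garp_time m n) & b <-> GARP x p.
Proof.
pose e : rel 'I_l := fun s t => 0 <= dot (p s) (x s - x t).
pose strict : rel 'I_l := fun s t => 0 < dot (p t) (x t - x s).
have e_refl : reflexive e by move=> s; rewrite /e dotB subrr.
have [||w cl run_closure] := @runs_closureT l n ln _ e [seq datum t | t <- enum 'I_l] 0 e.
- by rewrite size_map size_enum_ord.
- by split=> //; exact: connect1.
have wE := closed_connect e_refl cl.
pose clash s := has (fun t => w s t && strict s t) (enum 'I_l).
exists (~~ has clash (enum 'I_l)).
  apply: (runs_bind (v := table e)).
    apply: runs_table => // s t; apply: runs_bind (runs_gainT s t) _; exact: runs_op.
  apply: (runs_bind (v := table strict)).
    apply: runs_table => // s t; apply: runs_bind (runs_gainT t s) _; exact: runs_op.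
  apply: runs_bind.
    apply: runs_weak run_closure.
    by rewrite size_map leq_loop.
  apply: (runs_bind (v := map clash (enum 'I_l))).
    apply: (runs_map2T enum_le) => s _; apply: runs_bind.
      by apply: (runs_map2T enum_le) => t _; exact: runs_ret.
    by apply: (runs_hasT enum_le) => t _; exact: runs_ret.
  by apply: runs_bind_ret; apply: (runs_hasT enum_le) => s _; exact: runs_ret.
rewrite /GARP; split=> [/hasPn noclash [t [ts [pth gain]]]|garp].
  have /negP := noclash t (mem_enum _ _); apply; apply/hasP; exists (last t ts).
    exact: mem_enum.
  by rewrite wE /strict gain andbT; apply/connectP; exists ts.
apply/hasPn => s _; apply/hasPn => t _; rewrite wE; apply/negP => /andP[/connectP[ts pth ->]].
by move=> gain; apply: garp; exists s, ts.
Qed.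

End TestGARP.

(** * Cells of a survey *)

Definition cells_count m n := (2 * (n * m).+1)%N.
Definition cells_time m n :=
  (loop n (loop m (3 * (n * m).+1)) + (n * m).+1 * (7 * (n * m).+1 + m + 12))%N.
Definition pick_time m := (2 + m.+1)%N.

(** The point [z] witnesses that the prefix [pi] is within the bounds and that these
    are nonnegative, as needed for the zeros that fill up the point. *)
Lemma fillT_spec (R : realFieldType) (caps pi z : seq R) v :
  in_box caps z -> take (size pi) z = pi -> (size pi < size caps)%N ->
  0 <= v <= nth 0 caps (size pi) ->
  [/\ in_box caps (fillT pi v caps).1, take (size pi) (fillT pi v caps).1 = pi,
      nth 0 (fillT pi v caps).1 (size pi) = v & ((fillT pi v caps).2 <= (size caps).+1)%N].
Proof.
elim: caps pi z => [|c caps IH] [|x pi] [|y z] //=.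
  move=> /andP[_ boxz] _ _ ->; rewrite mapT_val /= addn0; split=> //.
  rewrite /in_box all2E size_map eqxx /=.
  elim: caps z boxz {IH} => [|c' caps IH] [|y' z] //= /andP[/andP[y0 yc] boxz].
  by rewrite lexx (le_trans y0 yc) (IH _ boxz).
move=> /andP[xc boxz] [<- takez] ltpi vc.
have [box take_pi nth_v time] := IH _ _ boxz takez ltpi vc.
by rewrite xc box take_pi nth_v addn0.
Qed.

Section SurveyCells.
Context (R : realType) (m n : nat) (D : survey R m n).
Hypothesis m_gt0 : (0 < m)%N.
Hypothesis survD : is_survey D.
Implicit Types (y : 'rV[R]_m) (pi : seq R) (J : interval R).

Let a0 i j : a D i 0 j != 0. Proof. by case: survD. Qed.
Let qB i : budget D i (q D i). Proof. by case: survD. Qed.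
Let qX i : X D (q D i). Proof. by case: (qB i). Qed.

Lemma in_box_coords y : in_box (coords (cap D)) (coords y) <-> X D y.
Proof.
rewrite /in_box all2E !size_coords eqxx /= /coords zip_map all_map.
by split=> [/allP box j|Xy]; [apply: box; rewrite mem_enum|apply/allP => j _; exact: Xy].
Qed.

Lemma coords_nth (s : seq R) : size s = m -> exists y, s = coords y.
Proof.
move=> sz; exists (\row_j nth 0 s j).
apply: (@eq_from_nth _ 0); rewrite ?size_coords ?sz// => j ltj.
by rewrite (nth_coords _ (Ordinal ltj)) mxE.
Qed.

Let tree := prefix_treeT (rounds (encode D)).

Let treeP :
  [/\ represents m (fun key => exists2 i, i \in enum 'I_n & key = coords (q D i)) tree.1,
      (nodes m tree.1 <= (n * m).+1)%N &
      (tree.2 <= loop n (loop m (3 * (n * m).+1)))%N].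
Proof.
have [|] := @prefix_treeP _ _ (round_of D) (enum 'I_n) m.
  by move=> i _; rewrite size_coords.
by rewrite size_enum_ord.
Qed.

Let key_box s : (exists2 i, i \in enum 'I_n & s = coords (q D i)) -> in_box (coords (cap D)) s.
Proof. by move=> [i _ ->]; apply/in_box_coords. Qed.

Lemma cells_size_time :
  (size (cellsT (encode D)).1 <= cells_count m n)%N /\
  ((cellsT (encode D)).2 <= cells_time m n)%N.
Proof.
have [_ nodes_tree time_tree] := treeP.
have [||size_cells time_cells] := @cells_cost _ (n * m).+1 m (coords (cap D)) [::] tree.1.
- by rewrite size_coords.
- by rewrite size_coords.
rewrite size_coords in size_cells time_cells.
rewrite /cellsT /cells_count /cells_time /= -/tree; split.
  by apply: leq_trans (ltnW size_cells) _; rewrite leq_mul2l nodes_tree orbT.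
apply: leq_add => //; apply: leq_trans (leq_mul nodes_tree (leqnn _)).
by apply: leq_trans time_cells; rewrite -[leqLHS]addn0 leq_add.
Qed.

Lemma cells_survey_sound pi J : (pi, J) \in (cellsT (encode D)).1 ->
  [/\ (size pi < m)%N, exists2 z, X D z & take (size pi) (coords z) = pi,
      (itv_pointT J).1 \in J, forall x, x \in J -> 0 <= x <= nth 0 (coords (cap D)) (size pi) &
      forall i, take (size pi) (coords (q D i)) = pi -> nth 0 (coords (q D i)) (size pi) \notin J].
Proof.
have [repr _ _] := treeP; rewrite /cellsT /= -/tree => J_in.
have [|pi' [[-> szpi] prefix pJ boundsJ freeJ]] := cells_sound _ key_box J_in.
  by rewrite size_coords.
rewrite size_coords in szpi; split=> // [|i take_q].
  case: prefix => [->|[s [i _ E]]]; last first.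
    by exists (q D i) => //; rewrite -E take_size_cat.
  exists 0; last by rewrite take0.
  by move=> j; rewrite mxE lexx ltW//; case: survD.
rewrite /= in take_q *; apply: (freeJ _ (drop (size pi').+1 (coords (q D i)))).
exists i; rewrite ?mem_enum//.
by rewrite -{1}take_q -drop_nth ?size_coords// cat_take_drop.
Qed.

Lemma cells_survey_cover y : X D y -> ~ answers D y ->
  exists pi J, (pi, J) \in (cellsT (encode D)).1 /\ cell D pi J y.
Proof.
have [repr _ _] := treeP => Xy notans.
have [||||pi [J [J_in take_y y_in]]] :=
  @cells_cover _ (coords (cap D)) [::] (coords y) tree.1 _ _ key_box.
- by rewrite size_coords.
- by left; rewrite size_coords.
- exact/in_box_coords.
- by move=> [i _ /coords_inj yq]; apply: notans; exists i.
by exists pi, J.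
Qed.

(** An answer with prefix [pi] has its next coordinate outside [J]. *)
Lemma cell_not_answer pi J y : (pi, J) \in (cellsT (encode D)).1 -> cell D pi J y ->
  ~ answers D y.
Proof.
move=> /cells_survey_sound[_ _ _ _ freeJ] [_ take_y y_in] [i _ qy].
by have := freeJ i; rewrite qy take_y y_in => /(_ erefl).
Qed.

Definition tau_vec y : 'rV[R]_n :=
  \row_i (tau_roundT (coords (a D i)) (coords (q D i)) (coords y)).1.

Lemma runs_tauT y :
  runs (tauT (encode D) (coords y)) (coords (tau_vec y)) (loop n (loop m 4)).
Proof.
rewrite -coords_row; apply: (runs_mapT (leq_enum_ord n)) => i _.
by apply: runs_tau_roundT; rewrite size_coords.
Qed.

Lemma tau_vec_cell pi J y z : (pi, J) \in (cellsT (encode D)).1 ->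
  cell D pi J y -> cell D pi J z -> tau_vec y = tau_vec z.
Proof.
move=> /cells_survey_sound[szpi _ _ _ freeJ] [_ take_y y_in] [_ take_z z_in].
apply/rowP => i; rewrite !mxE; apply: (@tau_round_cell _ J (size pi)); rewrite ?size_coords//.
  by rewrite take_y.
by rewrite take_y; exact: freeJ.
Qed.

Lemma tau_vec_signed y i : ~ answers D y -> signed (tau_vec y 0 i).
Proof.
move=> notans; rewrite mxE; apply: tau_round_signed; rewrite ?size_coords//.
  by apply/eqP => /coords_inj yq; apply: notans; exists i.
by move=> j ltj; rewrite (nth_coords _ (Ordinal ltj)).
Qed.

Lemma tau_vec_oriented y (s : 'I_n -> R) : ~ answers D y ->
  (forall i, signed (s i) /\ oriented D i (s i) y) -> tau_vec y = \row_i s i.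
Proof.
move=> notans so; apply/rowP => i; rewrite !mxE; have [ss oy] := so i.
apply: tau_round_oriented; rewrite ?size_coords//.
  by apply/eqP => /coords_inj yq; apply: notans; exists i.
move=> j ltj; rewrite !(nth_coords _ (Ordinal ltj)).
by split; [exact: a0|exact: oy].
Qed.

Lemma std_pick_spec pi J : (pi, J) \in (cellsT (encode D)).1 ->
  exists2 y, cell D pi J y & runs (std_pick (encode D) pi J) (coords y) (pick_time m).
Proof.
move=> /cells_survey_sound[szpi [z Xz take_z] pJ boundsJ _].
have [||||boxy take_y nth_y time] := @fillT_spec _ (coords (cap D)) pi (coords z) (itv_pointT J).1.
- exact/in_box_coords.
- exact: take_z.
- by rewrite size_coords.
- exact: boundsJ.
have [|y yE] := coords_nth (s := (fillT pi (itv_pointT J).1 (coords (cap D))).1).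
  by move: boxy; rewrite /in_box all2E size_coords => /andP[/eqP <-].
rewrite yE in boxy take_y nth_y *.
exists y; first by split; rewrite ?nth_y//; exact/in_box_coords.
split; [exact: yE|apply: (@leq_add _ _ 2 m.+1)]; last by rewrite size_coords in time.
by case: J {boundsJ pJ nth_y yE take_y time} => [[[] ?|[]] [[] ?|[]]].
Qed.

End SurveyCells.

(** * The algorithm *)

Definition tau_time m n := loop n (loop m 4).
Definition omega_time m n k :=
  (cells_time m n + (loop (cells_count m n) (k + tau_time m n) +
   loop (cells_count m n) (box_time m n + non_answer_time m n)))%N.
Definition try_pattern_time m n k := (loop n (loop m 1) + (k + k))%N.
Definition orient_towards_time m :=
  (loop m 1 + (loop m 1 + (loop m 1 + (loop m 1 + loop m 1))))%N.
Definition try_answer_time m n k :=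
  (loop n (eqv_time m) + (loop n (orient_towards_time m) + (loop n 0 +
   (loop n (0 + loop 1 0) + k))))%N.
Definition algorithm_time m n k :=
  (omega_time m n k + (loop (cells_count m n) (try_pattern_time m n k) +
   loop n (try_answer_time m n k)))%N.

Lemma InP (T : eqType) (x : T) s : reflect (List.In x s) (x \in s).
Proof.
elim: s => [|y s IH]; first by constructor.
rewrite in_cons; apply: (iffP predU1P) => -[->|/IH ?]; by [left|right].
Qed.

Lemma ohead_pmapP (S : eqType) (T : eqType) (g : S -> option T) s :
  if ohead (pmap g s) is Some y then exists2 x, x \in s & g x = Some y
  else {in s, forall x, g x = None}.
Proof.
elim: s => [|x s IH] //=; case gx: (g x) => [y|] /=.
  by exists x; rewrite ?mem_head.
case: (ohead _) IH => [y [x' x's gx']|none].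
  by exists x' => //; rewrite in_cons x's orbT.
by move=> x'; rewrite in_cons => /predU1P[->|/none].
Qed.

Section Algorithm.
Context (R : realType) (m n : nat) (D : survey R m n).
Hypothesis m_gt0 : (0 < m)%N.
Hypothesis survD : is_survey D.
Implicit Types (y : 'rV[R]_m) (sigma : 'rV[R]_n) (pi : seq R) (J : interval R).

Let a0 i j : a D i 0 j != 0. Proof. by case: survD. Qed.
Let qB i : budget D i (q D i). Proof. by case: survD. Qed.
Let qX i : X D (q D i). Proof. by case: (qB i). Qed.

Lemma runs_orientT s i :
  runs (orientT s (round_of D i)) (coords (q D i), coords (s *: a D i)) (loop m 1).
Proof.
apply: runs_bind_ret; rewrite (_ : coords (s *: a D i) = [seq s * a D i 0 j | j <- enum 'I_m]).
  by apply: (runs_mapT (leq_enum_ord m)) => j _; exact: runs_op.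
by apply: eq_map => j; rewrite mxE.
Qed.

(** A peak that is not an answer leaves all rounds subject to GARP, and it enters the
    condition through its pattern only. *)
Lemma pattern_rationalizable sigma y : (forall i, signed (sigma 0 i)) ->
  orthant_box D sigma y -> ~ answers D y ->
  rationalizable_with_peak D y <-> GARP (q D) (fun i => sigma 0 i *: a D i).
Proof.
move=> ss /(orthant_boxE D y ss)[Xy oy] notans.
have fP i : (q D i != y) = (i \in codom id).
  rewrite [RHS](_ : _ = true); last by apply/codomP; exists i.
  by apply/eqP => qy; apply: notans; exists i.
split; first exact: (rationalizable_GARP (f := id) a0 qB fP ss (fun i _ => oy i)).
exact: (GARP_rationalizable (f := id) a0 qB Xy fP ss (fun i _ => oy i)).
Qed.

Section Subroutines.
Context (sub : @subroutines R) (k : nat).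
Hypothesis sub_ok : implements D sub k.

Definition compute_pattern (c : seq R * interval R) : timed (seq R) :=
  let* v := pick_point sub (encode D) c.1 c.2 in tauT (encode D) v.

Definition pattern_of c := (compute_pattern c).1.

Definition retained (sigma : seq R) : bool :=
  (let* box := boxT (encode D) sigma in has_non_answerT (encode D) box).1.

Let cells := (cellsT (encode D)).1.

Lemma cell_pattern c : c \in cells ->
  exists2 y, cell D c.1 c.2 y &
    runs (compute_pattern c) (coords (tau_vec D y)) (k + tau_time m n)%N.
Proof.
case: c => pi J c_in; have [[y cy pick_y] time] := pick_point_ok sub_ok c_in.
exists y => //; apply: (runs_bind (v := coords y)); first by split.
exact: runs_tauT.
Qed.

Lemma runs_retained sigma : (forall i, signed (sigma 0 i)) ->
  runs (let* box := boxT (encode D) (coords sigma) in has_non_answerT (encode D) box)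
    (retained (coords sigma)) (box_time m n + non_answer_time m n)%N /\
  (retained (coords sigma) <-> (orthant_box D sigma `\` answers D) !=set0).
Proof.
move=> ss; have [b run_b bP] := runs_has_non_answerT D (sides D sigma).
have run := runs_bind (runs_boxT D sigma) run_b.
rewrite /retained run.1; split=> //; rewrite bP; split=> -[y].
  move=> /(sidesP _ a0 ss) oy notans; exists y; split=> //.
  exact/(orthant_boxE D y ss).
by move=> [/(orthant_boxE D y ss)/(sidesP _ a0 ss) oy notans]; exists y.
Qed.

Lemma cell_pattern_signed c : c \in cells ->
  exists2 sigma : 'rV[R]_n, pattern_of c = coords sigma & forall i, signed (sigma 0 i).
Proof.
move=> c_in; have [y cy [pat_y _]] := cell_pattern c_in.
exists (tau_vec D y) => // i; apply: tau_vec_signed => //.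
by apply: cell_not_answer cy => //; case: c c_in {pat_y}.
Qed.

Definition omega := [seq c <- cells | retained (pattern_of c)].

Lemma runs_omegaT :
  runs (omegaT sub (encode D)) [seq pattern_of c | c <- omega] (omega_time m n k).
Proof.
have [size_cells time_cells] := cells_size_time D.
apply: (runs_bind (v := cells)); first by split.
apply: (runs_bind (v := [seq pattern_of c | c <- cells])).
  rewrite -[X in mapT _ X]map_id.
  apply: (runs_mapT size_cells) => c /InP c_in; have [y _ run] := cell_pattern c_in.
  by rewrite /pattern_of run.1.
apply: (runs_filterT (g := retained \o pattern_of) size_cells) => c /InP c_in.
have [sigma E ss] := cell_pattern_signed c_in; rewrite /= E.
by have [] := runs_retained ss.
Qed.

Definition tried (sigma : seq R) := (try_patternT sub (encode D) sigma).1.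

Lemma runs_try_patternT sigma : (forall i, signed (sigma 0 i)) ->
  (orthant_box D sigma `\` answers D) !=set0 ->
  runs (try_patternT sub (encode D) (coords sigma)) (tried (coords sigma))
    (try_pattern_time m n k) /\
  if tried (coords sigma) is Some v then
    exists2 y, v = coords y & rationalizable_with_peak D y
  else ~ GARP (q D) (fun i => sigma 0 i *: a D i).
Proof.
move=> ss nonempty.
pose data := [seq (coords (q D i), coords (sigma 0 i *: a D i)) | i <- enum 'I_n].
have run_data : runs (map2T orientT (coords sigma) (rounds (encode D))) data (loop n (loop m 1)).
  by apply: (runs_map2T (leq_enum_ord n)) => i _; exact: runs_orientT.
have [garpP garp_time] := test_garp_ok sub_ok (q D) (fun i => sigma 0 i *: a D i) (leqnn n).
have run_garp : runs (test_garp sub data) (test_garp sub data).1 k by split.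
have [[y [boxy notans] peak_y] peak_time] := choose_peak_ok sub_ok ss nonempty.
have run_peak : runs (choose_peak sub (encode D) (coords sigma)) (coords y) k by split.
have [b run_b bP] : exists2 r, runs (try_patternT sub (encode D) (coords sigma)) r
    (try_pattern_time m n k) & if r is Some v then
    exists2 y, v = coords y & rationalizable_with_peak D y
  else ~ GARP (q D) (fun i => sigma 0 i *: a D i).
  have [ok|notok] := boolP (test_garp sub data).1.
    exists (Some (coords y)).
      apply: (runs_bind run_data); apply: (runs_bind run_garp); rewrite ok.
      exact: runs_bind_ret run_peak.
    by exists y => //; apply/(pattern_rationalizable ss boxy notans)/garpP.
  exists None; last by move/garpP/(negP notok).
  apply: (runs_bind run_data); apply: (runs_bind run_garp); rewrite (negPf notok).
  exact: runs_weak (leq0n _) (runs_ret _).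
by rewrite /tried run_b.1.
Qed.

(** ** Peaks among the answers *)

(** The sign that orients the round toward [y], if one does; [in_cone] tests whether
    this sign does. *)
Definition side_of y i : R :=
  if [forall j, 0 <= a D i 0 j * (y 0 j - q D i 0 j)] then 1 else -1.

Definition in_cone y i : bool :=
  [forall j, 0 <= side_of y i * a D i 0 j * (y 0 j - q D i 0 j)].

Lemma side_of_signed y i : signed (side_of y i).
Proof. by rewrite /side_of; case: ifP => _; [left|right]. Qed.

Lemma side_of_oriented y i s : signed s -> oriented D i s y -> y != q D i ->
  side_of y i = s.
Proof.
move=> ss oy yq; rewrite /side_of; case: ifP => [/forallP pos|/negP notpos].
  case: ss oy => // -> oy; exfalso; move/negP: yq; apply; apply/eqP/rowP => j.
  have := oy j; rewrite mulN1r mulNr oppr_ge0 => neg.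
  have /eqP : a D i 0 j * (y 0 j - q D i 0 j) = 0 by apply/le_anti; rewrite neg pos.
  by rewrite mulf_eq0 (negPf (a0 i j)) subr_eq0 => /eqP.
case: ss oy => // -> oy; case: notpos; apply/forallP => j.
by have := oy j; rewrite mul1r.
Qed.

Lemma in_coneP y i : reflect (oriented D i (side_of y i) y) (in_cone y i).
Proof. exact: forallP. Qed.

Lemma runs_orient_towardsT y i :
  runs (orient_towardsT (coords y) (round_of D i))
    (if in_cone y i then Some (coords (q D i), coords (side_of y i *: a D i)) else None)
    (orient_towards_time m).
Proof.
pose d j := a D i 0 j * (y 0 j - q D i 0 j).
apply: (runs_bind (v := [seq y 0 j - q D i 0 j | j <- enum 'I_m])).
  by apply: (runs_map2T (leq_enum_ord m)) => j _; exact: runs_op.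
apply: (runs_bind (v := [seq d j | j <- enum 'I_m])).
  by apply: (runs_map2T (leq_enum_ord m)) => j _; exact: runs_op.
have allE (P : pred 'I_m) : all P (enum 'I_m) = [forall j, P j].
  by apply/allP/forallP => H j => [|_]; apply: H; exact: mem_enum.
apply: (runs_bind (v := [forall j, 0 <= d j])).
  by rewrite -allE; apply: (runs_allT (leq_enum_ord m)) => j _; exact: runs_op.
have [pos|notpos] := boolP [forall j, 0 <= d j].
  rewrite /in_cone /side_of pos ifT; last first.
    by apply/forallP => j; rewrite mul1r; exact: (forallP pos).
  apply: (runs_weak _ (runs_bind_ret _ (runs_orientT 1 i))).
  exact: leq_addr.
apply: (runs_bind (v := [forall j, d j <= 0])).
  by rewrite -allE; apply: (runs_allT (leq_enum_ord m)) => j _; exact: runs_op.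
rewrite /in_cone /side_of (negPf notpos).
have -> : [forall j, 0 <= -1 * a D i 0 j * (y 0 j - q D i 0 j)] = [forall j, d j <= 0].
  by apply: eq_forallb => j; rewrite mulN1r mulNr oppr_ge0.
case: ifP => _; first exact: runs_bind_ret (runs_orientT _ _).
exact: runs_weak (leq0n _) (runs_ret _).
Qed.

Definition tried_answer y := (try_answerT sub (encode D) (coords y)).1.

(** If a round with another answer is not oriented toward [y], then [y] cannot be a
    peak.  Otherwise the oriented rounds decide. *)
Lemma runs_try_answerT y : X D y ->
  runs (try_answerT sub (encode D) (coords y)) (tried_answer y) (try_answer_time m n k) /\
  tried_answer y = if asbool (rationalizable_with_peak D y) then Some (coords y) else None.
Proof.
move=> Xy; pose s := [seq i <- enum 'I_n | q D i != y].
have size_s : (size s <= n)%N.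
  by rewrite (leq_trans (size_subseq (filter_subseq _ _))) ?size_enum_ord.
pose o i := if in_cone y i then Some (coords (q D i), coords (side_of y i *: a D i)) else None.
have run_others : runs (Defs.filterT (fun r => let* same := eqvT (answer r) (coords y) in
    ret (~~ same)) (rounds (encode D))) [seq round_of D i | i <- s] (loop n (eqv_time m)).
  apply: (runs_filterT (leq_enum_ord n)) => i _; apply: runs_bind_ret.
  exact: runs_eqvT.
have run_oriented : runs (mapT (orient_towardsT (coords y)) [seq round_of D i | i <- s])
    [seq o i | i <- s] (loop n (orient_towards_time m)).
  by apply: (runs_mapT size_s) => i _; exact: runs_orient_towardsT.
have run_cones : runs (Defs.allT (fun o => ret (isSome o)) [seq o i | i <- s])
    (all (in_cone y) s) (loop n 0).
  apply: (runs_allT size_s) => i _; rewrite /o.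
  by case: (in_cone y i); exact: runs_ret.
have [/allP cones|notcones] := boolP (all (in_cone y) s); last first.
  have notrat : ~ rationalizable_with_peak D y.
    move=> /rationalizable_oriented[_ [t tP]]; case/allPn: notcones => i.
    rewrite mem_filter => /andP[qy _] /in_coneP[]; have [ti oy] := tP i.
    by rewrite eq_sym in qy; rewrite (side_of_oriented ti (oy qy) qy); exact: oy.
  suff run : runs (try_answerT sub (encode D) (coords y)) None (try_answer_time m n k).
    by rewrite /tried_answer run.1 asboolF.
  apply: (runs_bind run_others); apply: (runs_bind run_oriented).
  apply: (runs_bind run_cones); rewrite (negPf notcones).
  exact: runs_weak (leq0n _) (runs_ret _).
pose f := tnth (in_tuple s).
have sE : [seq f t | t <- enum 'I_(size s)] = s := map_tnth_enum (in_tuple s).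
pose data :=
  [seq (coords (q D (f t)), coords (side_of y (f t) *: a D (f t))) | t <- enum 'I_(size s)].
have dataE : data = [seq (coords (q D i), coords (side_of y i *: a D i)) | i <- s].
  rewrite /data -[in RHS]sE -map_comp.
  by apply: eq_map.
have run_data : runs (flatmapT (fun o => ret (seq_of_opt o)) [seq o i | i <- s]) data
    (loop n (0 + loop 1 0)).
  rewrite dataE (_ : [seq _ | i <- s] = flatten [seq seq_of_opt (o i) | i <- s]).
    apply: (runs_flatmapT (l := 1) size_s) => i _; split; first exact: runs_ret.
    by rewrite /o; case: ifP.
  elim: (s) cones => //= i s' IH cones; rewrite -IH; last first.
    by move=> i' i's; apply: cones; rewrite in_cons i's orbT.
  by rewrite /o cones ?mem_head.
have fP i : (q D i != y) = (i \in codom f).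
  by rewrite /codom /image_mem [map _ _]sE mem_filter mem_enum andbT.
have oy i : y != q D i -> oriented D i (side_of y i) y.
  by move=> yq; apply/in_coneP/cones; rewrite mem_filter mem_enum eq_sym yq.
have ratP : GARP (q D \o f) (fun t => side_of y (f t) *: a D (f t)) <->
    rationalizable_with_peak D y.
  split; first exact: (GARP_rationalizable a0 qB Xy fP (side_of_signed y) oy).
  exact: (rationalizable_GARP a0 qB fP (side_of_signed y) oy).
have [garpP garp_time] :=
  test_garp_ok sub_ok (q D \o f) (fun t => side_of y (f t) *: a D (f t)) size_s.
have run_garp : runs (test_garp sub data) (asbool (rationalizable_with_peak D y)) k.
  split=> //; apply/idP/asboolP; first by move/garpP/ratP.
  by move/ratP/garpP.
suff run : runs (try_answerT sub (encode D) (coords y))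
    (if asbool (rationalizable_with_peak D y) then Some (coords y) else None)
    (try_answer_time m n k).
  by rewrite /tried_answer run.1.
apply: (runs_bind run_others); apply: (runs_bind run_oriented).
apply: (runs_bind run_cones); rewrite (_ : all _ _ = true); last exact/allP.
by apply: (runs_bind run_data); apply: runs_bind_ret run_garp.
Qed.

Lemma omegaP c : c \in omega ->
  exists2 sigma : 'rV[R]_n, pattern_of c = coords sigma &
    (forall i, signed (sigma 0 i)) /\ (orthant_box D sigma `\` answers D) !=set0.
Proof.
rewrite mem_filter => /andP[keep c_in]; have [sigma E ss] := cell_pattern_signed c_in.
by exists sigma => //; split=> //; apply/(runs_retained ss).2; rewrite -E.
Qed.

(** The point [y] lies in some cell, and on the cell the pattern is constant; so it
    does not matter which point of the cell is picked. *)
Lemma mem_omega y (s : 'I_n -> R) : X D y -> ~ answers D y ->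
  (forall i, signed (s i) /\ oriented D i (s i) y) ->
  exists2 c, c \in omega & pattern_of c = coords (\row_i s i).
Proof.
move=> Xy notans so; have [pi [J [c_in cy]]] := cells_survey_cover m_gt0 survD Xy notans.
have [z cz [pat_z _]] := cell_pattern c_in.
have pat_c : pattern_of (pi, J) = coords (\row_i s i).
  rewrite /pattern_of pat_z (tau_vec_cell survD c_in cz cy).
  by rewrite (tau_vec_oriented survD notans so).
have ss i : signed ((\row_i s i : 'rV[R]_n) 0 i) by rewrite mxE; case: (so i).
exists (pi, J) => //; rewrite mem_filter c_in andbT pat_c.
apply/(runs_retained ss).2; exists y; split=> //; apply/orthant_boxE => //.
by split=> // i; rewrite mxE; case: (so i).
Qed.

(** Every reported peak is one because both tests are equivalent to
    rationalizability with the peak at hand.  If some peak [y] exists and is not an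
    answer, then its pattern is in [omega], and its test succeeds, even if the point
    then chosen as a peak is not [y].  If [y] is an answer, the second loop tries it. *)
Lemma algorithm_correct :
  [/\ (algorithm sub (encode D)).1 <> None <-> rationalizable D,
      forall v, (algorithm sub (encode D)).1 = Some v ->
        exists2 y, v = coords y & rationalizable_with_peak D y &
      ((algorithm sub (encode D)).2 <= algorithm_time m n k)%N].
Proof.
pose g c := tried (pattern_of c).
have [size_cells _] := cells_size_time D.
have size_omega : (size omega <= cells_count m n)%N.
  by apply: leq_trans size_cells; rewrite size_filter count_size.
have run_patterns : runs (find_someT (try_patternT sub (encode D)) [seq pattern_of c | c <- omega])
    (ohead (pmap g omega)) (loop (cells_count m n) (try_pattern_time m n k)).
  apply: (runs_find_someT size_omega) => c /InP c_in.
  have [sigma E [ss nonempty]] := omegaP c_in; rewrite /g E.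
  by have [] := runs_try_patternT ss nonempty.
pose g' i := tried_answer (q D i).
have run_answers : runs
    (find_someT (fun r => try_answerT sub (encode D) (answer r)) (rounds (encode D)))
    (ohead (pmap g' (enum 'I_n))) (loop n (try_answer_time m n k)).
  apply: (runs_find_someT (leq_enum_ord n)) => i _.
  by have [] := runs_try_answerT (qX i).
pose v := if ohead (pmap g omega) is Some y then Some y else ohead (pmap g' (enum 'I_n)).
have run : runs (algorithm sub (encode D)) v (algorithm_time m n k).
  apply: (runs_bind runs_omegaT); apply: (runs_bind run_patterns).
  rewrite /v; case: (ohead _) => [y|]; last exact: run_answers.
  exact: runs_weak (leq0n _) (runs_ret _).
move: run => [vE time]; rewrite vE.
have sound z : v = Some z -> exists2 y, z = coords y & rationalizable_with_peak D y.
  rewrite /v; have := ohead_pmapP g omega; case: (ohead _) => [z' [c c_in gc] [<-]|_].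
    have [sigma E [ss nonempty]] := omegaP c_in.
    by have [_] := runs_try_patternT ss nonempty; rewrite -E -/(g c) gc.
  have := ohead_pmapP g' (enum 'I_n); case: (ohead _) => // z' [i _ gi] [<-].
  have [_] := runs_try_answerT (qX i); rewrite -/(g' i) gi.
  by case: asboolP => // rat [->]; exists (q D i).
split=> //; split=> [vN|[y rat]].
  by case vz: v vN => [z|//] _; have [y _ rat] := sound _ vz; exists y.
have [Xy [s so]] := rationalizable_oriented rat.
rewrite /v; have := ohead_pmapP g omega; case: (ohead _) => // none.
have [[i _ qy]|notans] := pselect (answers D y).
  have := ohead_pmapP g' (enum 'I_n); case: (ohead _) => // /(_ i (mem_enum _ _)).
  by have [_] := runs_try_answerT (qX i); rewrite -/(g' i) qy => ->; rewrite asboolT.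
have {}so i : signed (s i) /\ oriented D i (s i) y.
  have [si oy] := so i; split=> //; apply: oy.
  by apply/eqP => yq; apply: notans; exists i.
have [c c_in pat_c] := mem_omega Xy notans so.
have [sigma E [ss nonempty]] := omegaP c_in.
have sigmaE : sigma = \row_i s i by apply: coords_inj; rewrite -E.
have [_] := runs_try_patternT ss nonempty; rewrite -E -/(g c) none// => -[].
apply: (pattern_rationalizable ss _ notans).1 rat; apply/orthant_boxE => //.
by split=> // i; rewrite sigmaE mxE; case: (so i).
Qed.

End Subroutines.

(** ** The standard subroutines *)

Definition subroutines_time :=
  (pick_time m + (box_time m n + search_time m n n) + garp_time m n)%N.

Lemma std_choose_spec sigma : (forall i, signed (sigma 0 i)) ->
  (orthant_box D sigma `\` answers D) !=set0 ->
  exists2 y, (orthant_box D sigma `\` answers D) y &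
    runs (std_choose (encode D) (coords sigma)) (coords y) (box_time m n + search_time m n n).
Proof.
move=> ss [y [boxy notans]].
have /non_answer_candidate[sdP [k kn notans_k]] :
    exists2 y, in_sides (sides D sigma) y & ~ answers D y.
  by exists y => //; apply/(sidesP _ a0 ss)/(orthant_boxE D y ss).
have [|l notans_l run_l] := @searchP _ _ _ D (sides D sigma) (rounds (encode D)) 0.
  by exists k => //; rewrite size_map size_enum_ord.
exists (candidate (sides D sigma) l.+1%:R).
  split; last exact/is_answerP.
  by apply/(orthant_boxE D _ ss)/(sidesP _ a0 ss)/candidate_in; rewrite ?ler1n.
rewrite size_map size_enum_ord in run_l.
exact: runs_bind (runs_boxT D sigma) run_l.
Qed.

Lemma std_implements k : (subroutines_time <= k)%N -> implements D (std_subroutines R) k.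
Proof.
rewrite /subroutines_time => le_k; split.
- move=> pi J c_in c; have [y cy [run_y time]] := std_pick_spec survD c_in.
  by split; [exists y|apply: leq_trans time _; lia].
- move=> sigma ss nonempty c; have [y yP [run_y time]] := std_choose_spec ss nonempty.
  by split; [exists y|apply: leq_trans time _; lia].
- move=> l x p ln c; have [b [run_b time] bP] := runs_std_garp ln x p.
  split; last by apply: leq_trans time _; lia.
  by rewrite /c [X in is_true X]run_b.
Qed.

End Algorithm.

(** * Polynomial bounds *)

Definition polynomially_bounded (f : nat -> nat -> nat) : Prop :=
  exists c d, forall m n, (f m n <= c * (m + n).+1 ^ d)%N.

Lemma bounded_const c : polynomially_bounded (fun _ _ => c).
Proof. by exists c, 0%N => m n; rewrite muln1. Qed.

Lemma bounded_fst : polynomially_bounded (fun m _ => m).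
Proof. by exists 1%N, 1%N => m n; rewrite mul1n expn1; lia. Qed.

Lemma bounded_snd : polynomially_bounded (fun _ n => n).
Proof. by exists 1%N, 1%N => m n; rewrite mul1n expn1; lia. Qed.

Lemma bounded_add f g : polynomially_bounded f -> polynomially_bounded g ->
  polynomially_bounded (fun m n => f m n + g m n)%N.
Proof.
move=> [c [d fP]] [c' [d' gP]]; exists (c + c')%N, (d + d')%N => m n.
rewrite mulnDl leq_add//.
  by apply: leq_trans (fP m n) _; rewrite leq_mul2l leq_pexp2l ?leq_addr ?orbT.
by apply: leq_trans (gP m n) _; rewrite leq_mul2l leq_pexp2l ?leq_addl ?orbT.
Qed.

Lemma bounded_mul f g : polynomially_bounded f -> polynomially_bounded g ->
  polynomially_bounded (fun m n => f m n * g m n)%N.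
Proof.
move=> [c [d fP]] [c' [d' gP]]; exists (c * c')%N, (d + d')%N => m n.
by rewrite expnD mulnACA leq_mul.
Qed.

Lemma bounded_succ f : polynomially_bounded f -> polynomially_bounded (fun m n => (f m n).+1).
Proof.
move=> [c [d fP]]; exists c.+1, d => m n.
rewrite mulSn -add1n leq_add ?fP// expn_gt0.
by [].
Qed.

Lemma bounded_loop f g : polynomially_bounded f -> polynomially_bounded g ->
  polynomially_bounded (fun m n => loop (f m n) (g m n)).
Proof. by move=> fP gP; apply/bounded_succ/bounded_mul/bounded_succ. Qed.

Ltac bounded := repeat first
  [exact: bounded_fst | exact: bounded_snd | exact: bounded_const
  | apply: bounded_loop | apply: bounded_add | apply: bounded_mul | apply: bounded_succ].

Lemma subroutines_time_bounded : polynomially_bounded subroutines_time.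
Proof.
rewrite /subroutines_time /pick_time /box_time /search_time /garp_time /closure_time
  /closure_step_time /gain_time /is_answer_time /eqv_time.
by bounded.
Qed.

Lemma algorithm_time_bounded : polynomially_bounded (fun m n => algorithm_time m n 1).
Proof.
rewrite /algorithm_time /omega_time /try_pattern_time /try_answer_time
  /orient_towards_time /cells_time /cells_count /tau_time /box_time /non_answer_time
  /is_answer_time /eqv_time.
by bounded.
Qed.

Lemma loop_scale s b k : (loop s (b * k.+1) <= loop s b * k.+1)%N.
Proof. by rewrite /loop !mulSn mulnS mulnS !mulnDr; nia. Qed.

(** The bound is an affine function of [k] with nonnegative coefficients, and such a
    function is at most its value at one times [k.+1]. *)
Lemma algorithm_time_scale m n k :
  (algorithm_time m n k <= algorithm_time m n 1 * k.+1)%N.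
Proof.
have scale_loop s f g : (f <= g * k.+1)%N -> (loop s f <= loop s g * k.+1)%N.
  by move=> fg; apply: leq_trans (loop_scale s g k); rewrite leq_loop.
have scale_add f g f' g' : (f <= g * k.+1 -> f' <= g' * k.+1 -> f + f' <= (g + g') * k.+1)%N.
  by move=> fg fg'; rewrite mulnDl leq_add.
have scale_const f : (f <= f * k.+1)%N by rewrite leq_pmulr.
have scale_k : (k <= 1 * k.+1)%N by rewrite mul1n.
rewrite /algorithm_time /omega_time /try_pattern_time /try_answer_time.
by repeat first [exact: scale_k | exact: scale_const | apply scale_add | apply scale_loop].
Qed.

Theorem theorem2 :
  exists c d : nat, forall (R : realType) (m n : nat) (D : survey R m n),
    (0 < m)%N -> is_survey D ->
    let poly := (c * (m + n).+1 ^ d)%N in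
    implements D (std_subroutines R) poly /\
    forall (sub : subroutines) (k : nat), implements D sub k ->
      let run := algorithm sub (encode D) in
      [/\ run.1 <> None <-> rationalizable D,
          forall y, run.1 = Some y ->
            exists2 ystar : 'rV[R]_m,
              y = coords ystar & rationalizable_with_peak D ystar &
          (run.2 <= poly * k.+1)%N].
Proof.
have [c [d bound]] := bounded_add subroutines_time_bounded algorithm_time_bounded.
exists c, d => R m n D m_gt0 survD poly.
have [sub_le alg_le] : (subroutines_time m n <= poly)%N /\ (algorithm_time m n 1 <= poly)%N.
  by have := bound m n; rewrite -/poly; lia.
split=> [|sub k sub_ok]; first exact: std_implements.
have [rat sound time] := algorithm_correct m_gt0 survD sub_ok.
split=> //; apply: leq_trans time _; apply: leq_trans (algorithm_time_scale m n k) _.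
by rewrite leq_mul2r alg_le orbT.
Qed.
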